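(* Let $\pi$ be a probability density and $q$ a proposal density on $\mathbb{R}^d$ satisfying the target and proposal assumptions given in the context (with exponent $m\in(0,1)$), and let $P$ be the transition kernel of the symmetric random walk Hastings–Metropolis algorithm with target $\pi$ and increment density $q$. Then there exist $z>0$, $c>0$, $\varrho>0$ such that Condition $\mathbf{D}(\phi,V,C)$ (defined in the context) holds with $$V:=\pi^{-z},\qquad \phi(v):=c\,v\,(1+\log v)^{-2(1-m)/m},\qquad C:=\{x\in\mathbb{R}^d:|x|\le\varrho\}.$$
   Context: $|\cdot|$ and $\langle\cdot,\cdot\rangle$ are the Euclidean norm and scalar product (in any Euclidean space); $\nabla$ and $\nabla^2$ denote gradient and Hessian; $\mu_d$ is Lebesgue measure on $\mathbb{R}^d$; $PV(x)=\int P(x,dy)V(y)$. Condition $\mathbf{D}(\phi,V,C)$, for a kernel $P$ on a state space $\mathsf{X}$ (here $\mathsf{X}=\mathbb{R}^d$): there exist a function $V:\mathsf{X}\to[1,\infty)$, a concave monotone nondecreasing differentiable function $\phi:[1,\infty)\to(0,\infty]$, a measurable set $C$ and a finite constant $b$ such that $PV+\phi\circ V\le V+b\mathbf{1}_C$. Metropolis kernel: with $\alpha(x,y)=\min\{\pi(y)/\pi(x),1\}$ if $\pi(x)>0$ and $\alpha(x,y)=1$ if $\pi(x)=0$, $$P(x,A)=\int_{\mathbb{R}^d}\mathbf{1}_A(x+y)\,\alpha(x,x+y)\,q(y)\,d\mu_d(y)+\mathbf{1}_A(x)\int_{\mathbb{R}^d}\bigl(1-\alpha(x,x+y)\bigr)q(y)\,d\mu_d(y).$$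 Target assumption: $\pi$ is continuous and positive on $\mathbb{R}^d$ and there exist $m\in(0,1)$, $r\in(0,1)$, positive constants $d_i,D_i$, $i=0,1,2$, and $R_0<\infty$ such that, if $|x|\ge R_0$, $\pi$ is twice continuously differentiable and $$\Bigl\langle\frac{\nabla\pi(x)}{|\nabla\pi(x)|},\frac{x}{|x|}\Bigr\rangle\le-r,\qquad d_0|x|^m\le-\log\pi(x)\le D_0|x|^m,$$ $$d_1|x|^{m-1}\le|\nabla\log\pi(x)|\le D_1|x|^{m-1},\qquad d_2|x|^{m-2}\le|\nabla^2\log\pi(x)|\le D_2|x|^{m-2}.$$ Proposal assumption: $q$ is a symmetric probability density with respect to $\mu_d$, bounded away from zero in a neighborhood of $0$, and compactly supported, i.e. there is $c(q)$ such that $q(y)=0$ for all $|y|\ge c(q)$.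
   Formalization: φ is convex on [1,e^k], k=2(1-m)/m, and V<1 where π>1, so D(φ,V,C) fails literally; proved: the drift inequality for exactly φ, V, C, and full D for max(1,V) and a concave φ1 equal to φ on [v0,∞), where V≥v0 off C. *)

(* Defs.v *)
From HB Require Import structures.
From mathcomp Require Import all_boot all_order all_algebra.
From mathcomp Require Import all_classical all_reals all_analysis.

Set Implicit Arguments.
Unset Strict Implicit.
Unset Printing Implicit Defensive.

Import Order.TTheory GRing.Theory Num.Theory numFieldNormedType.Exports.

Local Open Scope classical_set_scope.
Local Open Scope ring_scope.

(* The norm that the library puts on matrices is the sup norm, whose topology
   is the Euclidean one; lengths are measured with [enorm].  On square matrices
   [enorm] is the Frobenius norm. *)
Definition edot (R : realType) (m n : nat) (A B : 'M[R]_(m, n)) : R :=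
  \sum_i \sum_j A i j * B i j.

Definition enorm (R : realType) (m n : nat) (A : 'M[R]_(m, n)) : R :=
  Num.sqrt (edot A A).

Definition gradient (R : realType) (d : nat) (f : 'rV[R]_d -> R)
    (x : 'rV[R]_d) : 'rV[R]_d :=
  \row_i 'D_(delta_mx 0 i) f x.

Definition hessian (R : realType) (d : nat) (f : 'rV[R]_d -> R)
    (x : 'rV[R]_d) : 'M[R]_d :=
  \matrix_(i, j) 'D_(delta_mx 0 j) (fun y => 'D_(delta_mx 0 i) f y) x.

Definition C2_at (R : realType) (d : nat) (f : 'rV[R]_d -> R)
    (x : 'rV[R]_d) : Prop :=
  \forall y \near x, [/\ differentiable f y, differentiable (gradient f) y
    & {for y, continuous (hessian f)}].

(* Row vectors carry the sigma-algebra generated by the coordinates, as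
   [n.-tuple T] does in the library; over R it is the Borel sigma-algebra. *)
Section measurable_rV.
Context (R : realType) (n : nat).

Let coors : 'I_n -> 'rV[R]_n -> measurableTypeR R := fun i v => v ord0 i.

Let rV_set0 : g_sigma_preimage coors set0.
Proof. exact: sigma_algebra0. Qed.

Let rV_setC A : g_sigma_preimage coors A -> g_sigma_preimage coors (~` A).
Proof. exact: sigma_algebraC. Qed.

Let rV_bigcup (F : (set 'rV[R]_n)^nat) :
  (forall i, g_sigma_preimage coors (F i)) ->
  g_sigma_preimage coors (\bigcup_i (F i)).
Proof. exact: sigma_algebra_bigcup. Qed.

HB.instance Definition _ := @isMeasurable.Build default_measure_display
  'rV[R]_n (g_sigma_preimage coors) rV_set0 rV_setC rV_bigcup.

End measurable_rV.

Definition rV_cons (R : realType) (n : nat)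
    (p : measurableTypeR R * 'rV[R]_n) : 'rV[R]_n.+1 :=
  row_mx (p.1 : R)%:M p.2.

Fixpoint lebesgue_rV (R : realType) (n : nat) : set 'rV[R]_n -> \bar R :=
  match n with
  | 0 => dirac (0 : 'rV[R]_0)
  | n'.+1 => pushforward (@lebesgue_measure R \x @lebesgue_rV R n')%E
               (@rV_cons R n')
  end.

Lemma product_sigma_finite d1 d2 (T1 : measurableType d1)
    (T2 : measurableType d2) (R : realType)
    (m1 : {sigma_finite_measure set T1 -> \bar R})
    (m2 : {sigma_finite_measure set T2 -> \bar R}) :
  sigma_finite setT (m1 \x m2)%E.
Proof.
have /sigma_finiteP[F [TF ndF Foo]] := sigma_finiteT m1.
have /sigma_finiteP[G [TG ndG Goo]] := sigma_finiteT m2.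
exists (fun n => F n `*` G n).
  rewrite -setXTT TF TG predeqE => -[x y]; split.
    move=> [/= [n _ Fnx] [k _ Gky]]; exists (maxn n k) => //; split.
    - by move: x Fnx; exact/subsetPset/ndF/leq_maxl.
    - by move: y Gky; exact/subsetPset/ndG/leq_maxr.
  by move=> [n _ []/= ? ?]; split; exists n.
move=> k; have [? ?] := Foo k; have [? ?] := Goo k.
split; first exact: measurableX.
by rewrite product_measure1E// lte_mul_pinfty// ge0_fin_numE.
Qed.

Lemma ex_sigma_finite_measure d (T : measurableType d) (R : realType)
    (mu : set T -> \bar R) :
  mu set0 = 0%E -> (forall A, 0 <= mu A)%E -> semi_sigma_additive mu ->
  sigma_finite setT mu ->
  exists nu : {sigma_finite_measure set T -> \bar R}, mu = nu.
Proof.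
move=> mu0 mu_ge0 mu_add sf.
pose M := isMeasure.Build _ _ _ mu mu0 mu_ge0 mu_add.
pose mum : {measure set T -> \bar R} := HB.pack mu M.
pose S := @Measure_isSigmaFinite.Build _ _ _ mum sf.
pose nu : {sigma_finite_measure set T -> \bar R} :=
  HB.pack (mum : set _ -> \bar R) M S.
by exists nu.
Qed.

Lemma pushforward_sigma_finite_measure d1 d2 (T1 : measurableType d1)
    (T2 : measurableType d2) (R : realType)
    (m : {measure set T1 -> \bar R}) (f : T1 -> T2) (g : T2 -> T1) :
  sigma_finite setT m ->
  measurable_fun setT f -> measurable_fun setT g -> cancel f g ->
  exists nu : {sigma_finite_measure set T2 -> \bar R}, pushforward m f = nu.
Proof.
move=> [F FT Ffin] mf mg fgK.
pose push := pushforward m f.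
have push0 : push set0 = 0%E by rewrite /push /pushforward preimage_set0 measure0.
have push_ge0 A : (0 <= push A)%E by exact: measure_ge0.
have push_add : semi_sigma_additive push.
  move=> G mG tG mUG; rewrite /push /pushforward preimage_bigcup.
  apply: measure_semi_sigma_additive.
  - by move=> k; rewrite -[_ @^-1` _]setTI; exact: mf.
  - apply/trivIsetP => /= i j _ _ ij; rewrite -preimage_setI.
    by move/trivIsetP : tG => /(_ i j I I ij) ->; rewrite preimage_set0.
  - by rewrite -preimage_bigcup -[_ @^-1` _]setTI; exact: mf.
have sf : sigma_finite setT push.
  exists (fun k => g @^-1` F k).
    by rewrite -preimage_bigcup -FT preimage_setT.
  move=> k; have [mF Fk] := Ffin k; split.
    by rewrite -[_ @^-1` _]setTI; exact: mg.
  rewrite /push /pushforward -comp_preimage.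
  rewrite (_ : _ \o _ = id) ?preimage_id//.
  by apply/funext => p /=; rewrite fgK.
exact: ex_sigma_finite_measure.
Qed.

Section lebesgue_rV_measure.
Context (R : realType).

Lemma measurable_rV_coord n (i : 'I_n) :
  measurable_fun setT (fun v : 'rV[R]_n => v ord0 i : measurableTypeR R).
Proof.
move=> _ Y mY; rewrite setTI; apply: sub_sigma_algebra => /=.
rewrite -bigcup_seq/=; exists i => /=; first by rewrite mem_index_enum.
by exists Y => //; rewrite setTI.
Qed.

Lemma measurable_fun_rV d (T : measurableType d) n (f : T -> 'rV[R]_n) :
  (forall i, measurable_fun setT (fun t => f t ord0 i : measurableTypeR R)) ->
  measurable_fun setT f.
Proof.
move=> mf _ Y; rewrite setTI.
pose F := [set B : set 'rV[R]_n | measurable (f @^-1` B)].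
suff FY : @measurable _ 'rV[R]_n `<=` F by move=> mY; exact: FY.
apply: smallest_sub.
- split.
  + by rewrite /F /= preimage_set0; exact: measurable0.
  + move=> A; rewrite /F /= => mA.
    by rewrite setTD preimage_setC; exact: measurableC.
  + by move=> A mA; rewrite /F /= preimage_bigcup; apply: bigcup_measurable => k _; exact: mA.
- rewrite -bigcup_seq => A [i _] [B mB <-] /=.
  rewrite /F /= setTI -comp_preimage.
  by have := mf i measurableT B mB; rewrite setTI.
Qed.

Lemma measurable_rV_cons n : measurable_fun setT (@rV_cons R n).
Proof.
apply: measurable_fun_rV => i; rewrite /rV_cons.
have [j ->|j ->] := split_ordP (i : 'I_(1 + n)).
  rewrite (_ : (fun t => _) = fst); first exact: measurable_fst.
  by apply/funext => t; rewrite (@row_mxEl R 1 1 n) mxE (ord1 j) eqxx mulr1n.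
rewrite (_ : (fun t => _) = (fun v : 'rV[R]_n => v ord0 j) \o snd).
  by apply: (measurableT_comp (measurable_rV_coord j)); exact: measurable_snd.
by apply/funext => t; rewrite (@row_mxEr R 1 1 n).
Qed.

Let rV_uncons n (v : 'rV[R]_n.+1) : measurableTypeR R * 'rV[R]_n :=
  (v ord0 ord0 : measurableTypeR R, @rsubmx R 1 1 n v).

Let measurable_rV_uncons n : measurable_fun setT (@rV_uncons n).
Proof.
apply: measurable_fun_pair; first exact: measurable_rV_coord.
apply: measurable_fun_rV => i.
under eq_fun do rewrite mxE.
exact: measurable_rV_coord.
Qed.

Let rV_consK n : cancel (@rV_cons R n) (@rV_uncons n).
Proof.
move=> [x v]; rewrite /rV_uncons /rV_cons row_mxKr; congr pair => /=.
rewrite [LHS](_ : _ = @row_mx R 1 1 n (x : R)%:M v ord0 (lshift n ord0)).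
  by rewrite row_mxEl mxE eqxx mulr1n.
by congr (fun_of_matrix _ _ _); exact/val_inj.
Qed.

Lemma lebesgue_rV_sigma_finite_measure n :
  exists nu : {sigma_finite_measure set 'rV[R]_n -> \bar R},
    @lebesgue_rV R n = nu.
Proof.
elim: n => [|n [nu IH]]; first by exists (@dirac _ 'rV[R]_0 (0 : 'rV[R]_0) R).
have [nu' nuE] := pushforward_sigma_finite_measure
  (product_sigma_finite (@lebesgue_measure R) nu)
  (@measurable_rV_cons n) (@measurable_rV_uncons n) (@rV_consK n).
by exists nu'; rewrite /= IH.
Qed.

Context (n : nat).

Let lebesgue_rV0 : @lebesgue_rV R n set0 = 0%E.
Proof. by have [nu ->] := lebesgue_rV_sigma_finite_measure n; exact: measure0. Qed.

Let lebesgue_rV_ge0 A : (0 <= @lebesgue_rV R n A)%E.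
Proof. by have [nu ->] := lebesgue_rV_sigma_finite_measure n; exact: measure_ge0. Qed.

Let lebesgue_rV_additive : semi_sigma_additive (@lebesgue_rV R n).
Proof.
have [nu ->] := lebesgue_rV_sigma_finite_measure n.
exact: measure_semi_sigma_additive.
Qed.

HB.instance Definition _ := isMeasure.Build _ _ _ (@lebesgue_rV R n)
  lebesgue_rV0 lebesgue_rV_ge0 lebesgue_rV_additive.

Let lebesgue_rV_sigma_finite : sigma_finite setT (@lebesgue_rV R n).
Proof.
have [nu ->] := lebesgue_rV_sigma_finite_measure n; exact: sigma_finiteT.
Qed.

HB.instance Definition _ := Measure_isSigmaFinite.Build _ _ _
  (@lebesgue_rV R n) lebesgue_rV_sigma_finite.

End lebesgue_rV_measure.

Definition probability_density (R : realType) (d : nat)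
    (f : 'rV[R]_d -> R) : Prop :=
  [/\ measurable_fun setT f, forall x, 0 <= f x
    & (\int[@lebesgue_rV R d]_x (f x)%:E = 1)%E].

Definition target_assumption (R : realType) (d : nat) (m : R)
    (p : 'rV[R]_d -> R) : Prop :=
  [/\ continuous p, forall x, 0 < p x, 0 < m < 1
    & exists r d0 D0 d1 D1 d2 D2 R0 : R,
      [/\ 0 < r < 1, 0 < d0 /\ 0 < D0, 0 < d1 /\ 0 < D1, 0 < d2 /\ 0 < D2
        & forall x, R0 <= enorm x ->
          let logp y := ln (p y) in
          [/\ C2_at p x,
              edot ((enorm (gradient p x))^-1 *: gradient p x)
                   ((enorm x)^-1 *: x) <= - r,
              d0 * enorm x `^ m <= - logp x <= D0 * enorm x `^ m,
              d1 * enorm x `^ (m - 1) <= enorm (gradient logp x)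
                <= D1 * enorm x `^ (m - 1)
            & d2 * enorm x `^ (m - 2) <= enorm (hessian logp x)
                <= D2 * enorm x `^ (m - 2)]]].

Definition proposal_assumption (R : realType) (d : nat)
    (q : 'rV[R]_d -> R) : Prop :=
  [/\ probability_density q, forall y, q (- y) = q y,
      exists2 e : R, 0 < e & \forall y \near (0 : 'rV[R]_d), e <= q y
    & exists cq : R, forall y, cq <= enorm y -> q y = 0].

Definition acceptance (R : realType) (d : nat) (p : 'rV[R]_d -> R)
    (x y : 'rV[R]_d) : R :=
  if 0 < p x then Num.min (p y / p x) 1 else 1.

Definition metropolis_kernel (R : realType) (d : nat) (p q : 'rV[R]_d -> R)
    (x : 'rV[R]_d) (A : set 'rV[R]_d) : \bar R :=
  (\int[@lebesgue_rV R d]_y (\1_A (x + y) * acceptance p x (x + y) * q y)%:E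
   + (\1_A x)%:E
     * \int[@lebesgue_rV R d]_y ((1 - acceptance p x (x + y)) * q y)%:E)%E.

Section drift_condition.
Context (R : realType) (disp : measure_display) (X : measurableType disp).
Implicit Types (P : X -> set X -> \bar R) (phi : R -> R) (V : X -> R).
Implicit Type C : set X.

Definition kernel_app P V (x : X) : \bar R := (\int[P x]_y (V y)%:E)%E.

Definition drift_inequality P phi V C : Prop :=
  exists b : R, forall x,
    (kernel_app P V x + (phi (V x))%:E <= (V x + b * \1_C x)%:E)%E.

(* One-sided at the endpoint 1. *)
Definition derivable_from1 phi : Prop :=
  forall v, 1 <= v ->
    cvg ((fun h : R => h^-1 * (phi (v + h) - phi v))
           @ within [set h | 1 <= v + h] (0 : R)^').

(* [phi] is a function on [1, +oo[; its values elsewhere are irrelevant. *)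
Definition condition_D P phi V C : Prop :=
  [/\ forall x, 1 <= V x,
      [/\ forall v, 1 <= v -> 0 < phi v,
          convex_function (`[1, +oo[ : set R^o) (fun v => - phi v),
          {in `[1, +oo[ &, {homo phi : u v / u <= v}}
        & derivable_from1 phi],
      measurable C
    & drift_inequality P phi V C].

(* Condition D up to inessential changes: [V] may dip below 1 on [C], and [phi]
   may fail to be concave nondecreasing on [1, v0[, below every value of [V] off
   [C].  The drift inequality is required of [phi] and [V] themselves, and
   [condition_D] in full of functions that differ from them there only.
   For phi v = c v (1 + ln v)^(-k) with k > 0, [condition_D] itself is never
   satisfied, since phi is strictly convex on [1, e^k]; and V = p^(-z) is below
   1 wherever the density p exceeds 1. *)
Definition condition_D_tail P phi V C : Prop :=
  drift_inequality P phi V C /\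
  exists (v0 : R) (phi1 : R -> R),
    [/\ 1 <= v0,
        forall v, v0 <= v -> phi1 v = phi v,
        forall x, ~ C x -> v0 <= V x
      & condition_D P phi1 (fun x => Num.max 1 (V x)) C].

Lemma condition_DW P phi V C :
  condition_D P phi V C -> condition_D_tail P phi V C.
Proof.
move=> D; have [V1 _ _ DV] := D; split => //; exists 1, phi; split => //.
by rewrite (_ : (fun x => _) = V)//; apply/funext => x; apply/max_idPr.
Qed.

End drift_condition.

(* Main.v *)
Require Import Defs.
From HB Require Import structures.
From mathcomp Require Import all_boot all_order all_algebra.
From mathcomp Require Import all_classical all_reals all_analysis.
From mathcomp Require Import measurable_realfun.
From mathcomp Require Import ring lra.
Import Order.TTheory GRing.Theory Num.Theory numFieldNormedType.Exports.
Local Open Scope classical_set_scope.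
Local Open Scope ring_scope.

Set Implicit Arguments.
Unset Strict Implicit.
Unset Printing Implicit Defensive.

(** Let [V = p `^ (- z)]. If a step [u] is proposed at [x], and the log-density
    decreases by [s = ln (p x) - ln (p (x + u))] along it, then the expected
    relative change of [V] is
      [gain z s = (expR (z * s) - 1) * min (expR (- s)) 1].
    To second order this is [z * s + z^2 * s^2 / 2], with an additional term
    [- z * s^2] when [0 < s], which comes from the rejections. By symmetry of
    the proposal, [u] and [- u] may be averaged ([ge0_integral_oppr]). The
    first-order terms [z * s] then cancel up to the second derivatives of
    [ln p], the rejection term counts for half of the increments, and for small
    [z] it exceeds the convexity term [z^2 * s^2 / 2] ([gain_pair_le]).

    Far from the origin, at distance [r], the steps are bounded while the
    gradient of [ln p] has size [r^(m-1)] and its Hessian size at most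
    [r^(m-2)]. Hence [s] is small, uniformly over the increments
    ([ln_first_order_bound], the mean value theorem used twice), the
    relative drift is at most [- z] times a multiple of [r^(2m-2)], because the
    proposal density is bounded below near 0 ([ball_in_halfspace]), and the
    Hessian contributes only [r^(m-2)], which is of smaller order as [0 < m].
    This is [metropolis_far_drift]. Finally [ln V] is at least of order [r^m],
    so that [(1 + ln V)^(-2(1-m)/m)] is at most of order [r^(2m-2)], and [phi]
    is absorbed by the drift as soon as [c] is small. On the ball of radius
    [rho] everything is bounded, since a step at most doubles the mean of [V]
    ([metropolis_app_le]).

    The function [phi] is concave only from [e^k] on, with [k = 2(1-m)/m]; below
    this value it is replaced by its tangent, whose slope is positive
    ([concave_subgeometric_rate]). The weight [max 1 V] is treated together with
    [V], both being of the form [max t V] with [0 <= t <= 1]. *)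

(** * Euclidean norm and scalar product *)

Section euclidean.
Context {R : realType} {m n : nat}.
Implicit Types A B C : 'M[R]_(m, n).

Lemma edotC A B : edot A B = edot B A.
Proof. by apply: eq_bigr => i _; apply: eq_bigr => j _; rewrite mulrC. Qed.

Lemma edotDl A B C : edot (A + B) C = edot A C + edot B C.
Proof.
rewrite /edot -big_split; apply: eq_bigr => i _.
by rewrite -big_split; apply: eq_bigr => j _; rewrite mxE mulrDl.
Qed.

Lemma edotZl a A B : edot (a *: A) B = a * edot A B.
Proof.
rewrite /edot mulr_sumr; apply: eq_bigr => i _.
by rewrite mulr_sumr; apply: eq_bigr => j _; rewrite mxE mulrA.
Qed.

Lemma edotNl A B : edot (- A) B = - edot A B.
Proof. by rewrite -scaleN1r edotZl mulN1r. Qed.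

Lemma edotDr A B C : edot A (B + C) = edot A B + edot A C.
Proof. by rewrite edotC edotDl !(edotC A). Qed.

Lemma edotZr a A B : edot A (a *: B) = a * edot A B.
Proof. by rewrite edotC edotZl edotC. Qed.

Lemma edotNr A B : edot A (- B) = - edot A B.
Proof. by rewrite edotC edotNl edotC. Qed.

Lemma edot_ge0 A : 0 <= edot A A.
Proof.
by apply: sumr_ge0 => i _; apply: sumr_ge0 => j _; rewrite -expr2 sqr_ge0.
Qed.

Lemma sqr_le_edot A i j : A i j ^+ 2 <= edot A A.
Proof.
rewrite /edot (bigD1 i)//= (bigD1 j)//= -addrA -expr2 lerDl addr_ge0//.
  by apply: sumr_ge0 => k _; rewrite -expr2 sqr_ge0.
by apply: sumr_ge0 => k _; apply: sumr_ge0 => l _; rewrite -expr2 sqr_ge0.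
Qed.

Lemma edot0_eq0 A : edot A A = 0 -> A = 0.
Proof.
move=> A0; apply/matrixP => i j; rewrite mxE; apply/eqP.
by rewrite -sqrf_eq0 eq_le sqr_ge0 -A0 sqr_le_edot.
Qed.

Lemma enorm_ge0 A : 0 <= enorm A.
Proof. exact: sqrtr_ge0. Qed.

Lemma sqr_enorm A : enorm A ^+ 2 = edot A A.
Proof. by rewrite sqr_sqrtr// edot_ge0. Qed.

Lemma enormN A : enorm (- A) = enorm A.
Proof. by rewrite /enorm edotNl edotNr opprK. Qed.

Lemma enormZ a A : enorm (a *: A) = `|a| * enorm A.
Proof.
by rewrite /enorm edotZl edotZr mulrA -expr2 sqrtrM ?sqr_ge0// sqrtr_sqr.
Qed.

Lemma normr_coord_le_enorm A i j : `|A i j| <= enorm A.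
Proof. by rewrite -sqrtr_sqr ler_sqrt ?edot_ge0// sqr_le_edot. Qed.

(** Cauchy-Schwarz: expanding the squared length of
    [edot B B *: A - edot A B *: B] gives [edot B B] times the defect in the
    inequality. *)
Lemma edot_le_enormM A B : `|edot A B| <= enorm A * enorm B.
Proof.
rewrite -sqrtr_sqr -sqrtrM ?edot_ge0// ler_sqrt ?mulr_ge0 ?edot_ge0//.
have [B0|B_neq0] := eqVneq (edot B B) 0.
  rewrite B0 mulr0 (edot0_eq0 B0) -(scale0r (0 : 'M[R]_(m, n))) edotZr mul0r.
  by rewrite expr0n.
have B_gt0 : 0 < edot B B by rewrite lt_neqAle eq_sym B_neq0 edot_ge0.
have := edot_ge0 (edot B B *: A - edot A B *: B).
rewrite edotDl !edotDr !edotNl !edotNr !edotZl !edotZr (edotC B A).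
rewrite (_ : _ + _ = edot B B * (edot A A * edot B B - edot A B ^+ 2));
  last by ring.
by rewrite pmulr_rge0// subr_ge0.
Qed.

Lemma enormD A B : enorm (A + B) <= enorm A + enorm B.
Proof.
rewrite -ler_sqr ?nnegrE ?addr_ge0 ?enorm_ge0//.
rewrite sqr_enorm edotDl !edotDr sqrrD !sqr_enorm (edotC B A).
have := le_trans (ler_norm _) (edot_le_enormM A B); lra.
Qed.

End euclidean.

Section euclidean_row.
Context {R : realType} {d : nat}.
Implicit Types u v x y : 'rV[R]_d.

Lemma edot_rowE u v : edot u v = \sum_j u 0 j * v 0 j.
Proof. by rewrite /edot big_ord1. Qed.

Lemma enorm_trmxM u : enorm (u^T *m u) = enorm u ^+ 2.
Proof.
rewrite -[RHS]ger0_norm ?sqr_ge0// -sqrtr_sqr; congr Num.sqrt.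
rewrite sqr_enorm expr2 edot_rowE.
rewrite mulr_suml; apply: eq_bigr => i _; rewrite mulr_sumr.
by apply: eq_bigr => j _; rewrite !mxE big_ord1 mxE; ring.
Qed.

(** A quadratic form is the scalar product of its matrix with the rank-one
    matrix of its argument, so that Cauchy-Schwarz for matrices bounds it by
    the Frobenius norm. *)
Lemma edot_trmxM (H : 'M[R]_d) u :
  edot H (u^T *m u) = \sum_i u 0 i * \sum_j u 0 j * H i j.
Proof.
apply: eq_bigr => i _; rewrite mulr_sumr; apply: eq_bigr => j _.
by rewrite mxE big_ord1 mxE; ring.
Qed.

Lemma continuous_enorm : continuous (@enorm R 1 d).
Proof.
move=> x; apply: (continuous_comp (f := fun v => edot v v) (g := Num.sqrt)).
  rewrite (_ : (fun v => _) = (fun v : 'rV[R]_d => \sum_j v 0 j * v 0 j)).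
    apply: (continuous_big (op := +%R)) => [|j _ v]; first exact: add_continuous.
    apply: (@continuousM _ _ (fun u : 'rV[R]_d => u 0 j)).
      exact: coord_continuous.
    exact: coord_continuous.
  by apply/funext => v; rewrite edot_rowE.
exact: sqrt_continuous.
Qed.

Lemma mx_norm_le_enorm u : `|u| <= enorm u.
Proof.
rewrite [leLHS]/Num.Def.normr /= mx_normrE; apply/bigmax_leP; split.
  exact: enorm_ge0.
by move=> [i j] _ /=; rewrite normr_coord_le_enorm.
Qed.

Lemma enorm_le_mx_norm u : enorm u <= d%:R * `|u|.
Proof.
have [d0|d_gt0] := posnP d.
  rewrite /enorm edot_rowE big1 ?sqrtr0 ?mulr_ge0// => -[i i_lt].
  by exfalso; rewrite d0 in i_lt.
rewrite -ler_sqr ?nnegrE ?mulr_ge0 ?enorm_ge0// sqr_enorm edot_rowE exprMn.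
apply: (@le_trans _ _ (\sum_(j < d) `|u| ^+ 2)).
  apply: ler_sum => j _; rewrite -expr2 -real_normK ?num_real//.
  rewrite ler_sqr ?nnegrE//.
  rewrite [leRHS]/Num.Def.normr /= mx_normrE.
  by apply/bigmax_geP; right; exists (0, j).
rewrite sumr_const card_ord -[leLHS]mulr_natl ler_wpM2r ?sqr_ge0//.
by rewrite expr2 ler_peMl// ler1n.
Qed.

Lemma compact_enorm_ball (r : R) : compact [set x : 'rV[R]_d | enorm x <= r].
Proof.
apply: bounded_closed_compact.
  exists r; split; first exact: num_real.
  move=> s rs x /= xr.
  by rewrite (le_trans (mx_norm_le_enorm x))// (le_trans xr)// ltW.
rewrite (_ : [set x | _] = @enorm R 1 d @^-1` [set y | y <= r])//.
apply: preimage_closed; last exact: closed_le.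
by move=> x _; exact: continuous_enorm.
Qed.

Lemma continuous_bounded_on_enorm_ball (f : 'rV[R]_d -> R) (r : R) :
  continuous f -> exists M, forall x, enorm x <= r -> f x <= M.
Proof.
move=> cf; have [ball0|ball_empty] :=
  pselect ([set x : 'rV[R]_d | enorm x <= r] !=set0).
  have [|c _ fc] := @compact_EVT_max _ R f _ ball0 (@compact_enorm_ball r).
    exact: continuous_subspaceT.
  by exists (f c) => x xr; apply: fc; rewrite inE.
by exists 0 => x xr; exfalso; apply: ball_empty; exists x.
Qed.

End euclidean_row.

(** * Lebesgue measure: reflections and cubes *)

Section lebesgue_rV_facts.
Context {R : realType}.

Lemma ge0_integral_invariant d (T : measurableType d)
    (mu : {measure set T -> \bar R}) (f : T -> T) (g : T -> \bar R) :
  measurable_fun setT f ->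
  (forall A, measurable A -> mu (f @^-1` A) = mu A) ->
  measurable_fun setT g -> (forall x, 0 <= g x)%E ->
  (\int[mu]_x g (f x) = \int[mu]_x g x)%E.
Proof.
move=> mf mu_f mg g0.
transitivity (\int[@pushforward _ _ T T R mu f]_x g x)%E.
  by rewrite ge0_integral_pushforward// preimage_setT.
by apply: eq_measure_integral => A mA _; exact: mu_f.
Qed.

Lemma measurable_rV_opp n : measurable_fun setT (-%R : 'rV[R]_n -> 'rV[R]_n).
Proof.
apply: measurable_fun_rV => i.
rewrite (_ : (fun v => _) = -%R \o (fun v : 'rV[R]_n => v ord0 i)).
  by apply: measurableT_comp => //; exact: measurable_rV_coord.
by apply/funext => v; rewrite mxE.
Qed.

Lemma measurable_rV_addl n (x : 'rV[R]_n) : measurable_fun setT (+%R x).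
Proof.
apply: measurable_fun_rV => i.
rewrite (_ : (fun v => _) = +%R (x ord0 i) \o (fun v : 'rV[R]_n => v ord0 i)).
  apply: measurableT_comp; last exact: measurable_rV_coord.
  exact: measurable_funD.
by apply/funext => v; rewrite mxE.
Qed.

Lemma measurable_preimage d d' (T : measurableType d) (T' : measurableType d')
    (f : T -> T') A :
  measurable_fun setT f -> measurable A -> measurable (f @^-1` A).
Proof. by move=> mf mA; rewrite -[_ @^-1` _]setTI; exact: mf. Qed.

(** The measure is an iterated product, so reflecting a set reflects its first
    coordinate and each of its sections: induction on the dimension. *)
Lemma lebesgue_rV_preimageN n (A : set 'rV[R]_n) :
  measurable A -> lebesgue_rV (-%R @^-1` A) = lebesgue_rV A.
Proof.
elim: n A => [|n IHn] A mA /=.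
  by congr dirac; apply/funext => v /=; rewrite (thinmx0 v) oppr0.
rewrite /pushforward; pose B := @rV_cons R n @^-1` A.
have mB : measurable B.
  by apply: measurable_preimage => //; exact: measurable_rV_cons.
rewrite /product_measure1.
transitivity (\int[@lebesgue_measure R]_x (lebesgue_rV (xsection B (- x)%R)))%E;
  last first.
  apply: (@ge0_integral_invariant _ (measurableTypeR R) lebesgue_measure -%R
    (@lebesgue_rV R n \o xsection B)) => //.
  - exact: lebesgue_measureN.
  - exact: measurable_fun_xsection.
apply: eq_integral => x _ /=; rewrite -(IHn (xsection B (- x)%R)); last first.
  exact: measurable_xsection.
congr lebesgue_rV; apply/seteqP; rewrite /B.
have consN (y : 'rV[R]_n) : @rV_cons R n ((- x)%R, - y) = - @rV_cons R n (x, y).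
  by rewrite /rV_cons /= (@opp_row_mx R 1 1 n) -rmorphN.
by split => y /=; rewrite /xsection /= !inE /= consN.
Qed.

Lemma ge0_integral_oppr n (g : 'rV[R]_n -> \bar R) :
  measurable_fun setT g -> (forall x, 0 <= g x)%E ->
  (\int[@lebesgue_rV R n]_x g (- x)%R = \int[@lebesgue_rV R n]_x g x)%E.
Proof.
apply: (ge0_integral_invariant (mu := @lebesgue_rV R n)).
  exact: measurable_rV_opp.
exact: lebesgue_rV_preimageN.
Qed.

(** Balls of row vectors are those of the sup norm, that is cubes. *)
Lemma rV_ballE n (c : 'rV[R]_n) (r : R) : 0 < r ->
  ball c r = [set v | forall i, ball (c ord0 i) r (v ord0 i)].
Proof.
move=> r0; apply/seteqP; split => [v [_ cv] i|v cv]; first exact: cv.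
by split => // i j; rewrite (ord1 i).
Qed.

Lemma measurable_rV_ball n (c : 'rV[R]_n) (r : R) : 0 < r ->
  measurable (ball c r).
Proof.
move=> r0.
have -> : ball c r = \bigcap_(i in [set: 'I_n])
    ((fun v : 'rV[R]_n => v ord0 i) @^-1` ball (c ord0 i) r).
  rewrite rV_ballE//.
  by apply/seteqP; split => v /= cv => [i _|i]; exact: cv.
apply: fin_bigcap_measurable => [|i _]; first exact: finite_finset.
apply: measurable_preimage; first exact: measurable_rV_coord.
exact: measurable_ball.
Qed.

Lemma lebesgue_rV_ball n (c : 'rV[R]_n) (r : R) : 0 < r ->
  lebesgue_rV (ball c r) = ((r *+ 2) ^+ n)%:E.
Proof.
move=> r0; elim: n c => [|n IHn] c /=.
  by rewrite diracE rV_ballE// mem_set// => -[].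
rewrite /pushforward (_ : _ @^-1` _ =
  ball (c ord0 ord0) r `*` ball (@rsubmx R 1 1 n c) r).
  rewrite product_measure1E; [|exact: measurable_ball|exact: measurable_rV_ball].
  rewrite exprS EFinM; congr (_ * _)%E; last exact: IHn.
  exact/lebesgue_measure_ball/ltW.
rewrite !rV_ballE//; apply/seteqP; split => -[x v] /=; rewrite /rV_cons /=.
  move=> cxv; split.
    have := cxv (lshift n ord0 : 'I_(1 + n)).
    rewrite (@row_mxEl R 1 1 n) mxE eqxx mulr1n.
    by rewrite (_ : lshift n ord0 = ord0)//; exact/val_inj.
  by move=> i; have := cxv (rshift 1 i); rewrite (@row_mxEr R 1 1 n) mxE.
move=> [cx cv] i; have [j ->|j ->] := split_ordP (i : 'I_(1 + n)).
  rewrite (@row_mxEl R 1 1 n) mxE (ord1 j) eqxx mulr1n.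
  by rewrite (_ : lshift n ord0 = ord0)//; exact/val_inj.
by rewrite (@row_mxEr R 1 1 n); have := cv j; rewrite mxE.
Qed.

End lebesgue_rV_facts.

(** * Integration against an image measure plus an atom *)

Section image_plus_atom.
Local Open Scope ereal_scope.
Context d d' (T : measurableType d) (S : measurableType d') {R : realType}.
Variables (mu : {measure set T -> \bar R}) (f : T -> S) (w : T -> R).
Hypotheses (mf : measurable_fun setT f) (mw : measurable_fun setT w).
Hypothesis w0 : forall t, (0 <= w t)%R.

Let image_measure (A : set S) := \int[mu]_t (\1_A (f t) * w t)%:E.

Let image_measureE A : image_measure A = \int[mu]_(t in f @^-1` A) (w t)%:E.
Proof.
rewrite [RHS]integral_mkcond; apply: eq_integral => t _.
rewrite patchE indicE; have [fA|fA] := boolP (f t \in A).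
  by rewrite mul1r mem_set//; exact: set_mem fA.
by rewrite mul0r memNset// => fA'; move/negP: fA; apply; exact/mem_set.
Qed.

Let image_measure0 : image_measure set0 = 0.
Proof. by rewrite image_measureE preimage_set0 integral_set0. Qed.

Let image_measure_ge0 A : 0 <= image_measure A.
Proof. by apply: integral_ge0 => t _; rewrite lee_fin mulr_ge0. Qed.

Let image_measure_additive : semi_sigma_additive image_measure.
Proof.
move=> F mF tF mUF; rewrite image_measureE preimage_bigcup.
rewrite (_ : (fun n => _) =
  (fun n => \sum_(0 <= i < n) \int[mu]_(t in f @^-1` F i) (w t)%:E)); last first.
  by apply/funext => n; apply: eq_bigr => i _; exact: image_measureE.
apply: (@semi_sigma_additive_nng_induced _ _ _ mu (EFin \o w)).
- exact/measurable_EFinP.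
- by move=> t; rewrite lee_fin.
- by move=> i; exact: measurable_preimage.
- apply/trivIsetP => /= i j _ _ ij; rewrite -preimage_setI.
  by move/trivIsetP : tF => /(_ _ _ _ _ ij) ->//; rewrite preimage_set0.
- by rewrite -preimage_bigcup; exact: measurable_preimage.
Qed.

Let image_mixin := isMeasure.Build _ _ _ image_measure
  image_measure0 image_measure_ge0 image_measure_additive.
Let image_pack : {measure set S -> \bar R} := HB.pack image_measure image_mixin.

Import HBNNSimple.

Let integral_image (g : S -> R) :
  measurable_fun setT g -> (forall s, (0 <= g s)%R) ->
  \int[image_pack]_s (g s)%:E = \int[mu]_t (g (f t) * w t)%:E.
Proof.
move=> mg g0.
have mg' : measurable_fun setT (EFin \o g) by exact/measurable_EFinP.
pose h := nnsfun_approx measurableT mg'.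
have hg s : (h n s)%:E @[n --> \oo] --> (g s)%:E.
  apply: (@cvg_nnsfun_approx _ _ _ _ measurableT _ mg') => // t _.
  by rewrite lee_fin.
have h_nd s : {homo (fun n => h n s) : n m / (n <= m)%N >-> (n <= m)%R}.
  by move=> n m nm; exact/lefP/nd_nnsfun_approx.
have h_simple n :
    \int[image_pack]_s (h n s)%:E = \int[mu]_t (h n (f t) * w t)%:E.
  rewrite integralT_nnsfun sintegralE.
  have mterm r : measurable_fun setT
      (fun t => (r * \1_(h n @^-1` [set r]) (f t) * w t)%:E).
    apply/measurable_EFinP/measurable_funM => //; apply: measurable_funM => //.
    by apply: measurableT_comp => //; exact: measurable_indic.
  have term0 r t : 0 <= (r * \1_(h n @^-1` [set r]) (f t) * w t)%:E.
    rewrite lee_fin mulr_ge0//.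
    have [r0|r0] := leP 0%R r; first by rewrite mulr_ge0.
    by rewrite preimage_nnfun0// indic0 mulr0.
  transitivity (\sum_(r \in range (h n))
      \int[mu]_t (r * \1_(h n @^-1` [set r]) (f t) * w t)%:E).
    apply: eq_fsbigr => r /[!inE] -[s _ <-].
    under [RHS]eq_integral do rewrite -mulrA EFinM.
    rewrite ge0_integralZl_EFin//.
      by move=> t _; rewrite lee_fin mulr_ge0.
    apply/measurable_EFinP/measurable_funM => //.
    by apply: measurableT_comp => //; exact: measurable_indic.
  rewrite -ge0_integral_fsum//; apply: eq_integral => t _.
  by rewrite (fimfunE (h n) (f t)) fsumEFin// mulr_fsuml.
transitivity (limn (fun n => \int[image_pack]_s (h n s)%:E)).
  rewrite -monotone_convergence//.
  - by apply: eq_integral => s _; apply/esym/cvg_lim.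
  - by move=> n; exact/measurable_EFinP/measurable_funP.
  - by move=> n s _; rewrite lee_fin.
  - by move=> s _ n m nm; rewrite lee_fin; exact: h_nd.
rewrite (eq_fun h_simple) -monotone_convergence//.
- apply: eq_integral => t _; apply/cvg_lim => //.
  under eq_fun do rewrite EFinM.
  by rewrite EFinM; apply: cvgeZr.
- move=> n; apply/measurable_EFinP/measurable_funM => //.
  by apply: measurableT_comp => //; exact/measurable_funP.
- by move=> n t _; rewrite lee_fin mulr_ge0.
- by move=> t _ n m nm; rewrite lee_fin ler_wpM2r//; exact: h_nd.
Qed.

(** The rejection part of a Metropolis kernel is an atom at the current point,
    its acceptance part the image of a weighted measure. The integral against
    the latter is obtained as usual, from simple functions and monotone
    convergence. *)
Lemma ge0_integral_image_add_dirac (x : S) (k : {nonneg R}) (g : S -> R) :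
  measurable_fun setT g -> (forall s, (0 <= g s)%R) ->
  \int[fun A => (\int[mu]_t (\1_A (f t) * w t)%:E
                 + (\1_A x)%:E * k%:num%:E)]_s (g s)%:E
  = \int[mu]_t (g (f t) * w t)%:E + (g x * k%:num)%:E.
Proof.
move=> mg g0; rewrite (_ : (fun A => _) =
    measure_add image_pack (mscale k (dirac x))).
  have mg' : measurable_fun setT (fun s => (g s)%:E) by exact/measurable_EFinP.
  rewrite ge0_integral_measure_add//; last by move=> s _; rewrite lee_fin.
  rewrite integral_image// ge0_integral_mscale//; last first.
    by move=> s _; rewrite lee_fin.
  by rewrite integral_dirac// diracT mul1e muleC.
by apply/funext => A; rewrite measure_addE /mscale/= /dirac muleC.
Qed.

End image_plus_atom.

(** * The gain of one step *)

Section gain.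
Context {R : realType}.
Implicit Types z s w a e : R.

(** If the log-density decreases by [s] in a step proposed by the symmetric
    random walk, then [gain z s] is the relative change of the weight
    [density `^ (- z)] that is expected once the acceptance probability
    [min (exp (- s)) 1] has been taken into account; see [one_step_gain]. *)
Definition gain z s : R := (expR (z * s) - 1) * Num.min (expR (- s)) 1.

(** Second-order upper bound of [gain z s / z] for small [s] and [z]. Upward
    moves of the weight ([0 <= s]) are damped by the rejections, which gives the
    coefficient [- 1/2]; on the other side there is no rejection, and the
    coefficient is of order [z] only. *)
Definition gain_bound s : R :=
  if 0 <= s then s - s ^+ 2 / 2 else s + s ^+ 2 / 8.

Lemma expR_le_inv w : w < 1 -> expR w <= (1 - w)^-1.
Proof.
move=> w1; rewrite -[leLHS]invrK -expRN lef_pV2 ?posrE ?expR_gt0 ?subr_gt0//.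
by have := expR_ge1Dx (- w).
Qed.

Lemma gain_le z s : 0 < z <= 1/8 -> `|s| <= 1/4 -> gain z s <= z * gain_bound s.
Proof.
move=> /andP[z0 z8]; rewrite ler_norml /gain /gain_bound => /andP[s_ge s_le].
have [s0|s0] := leP 0 s.
  have zs : 0 <= z * s by rewrite mulr_ge0// ltW.
  have zs1 : z * s <= 1/8 * s by rewrite ler_wpM2r.
  have -> : Num.min (expR (- s)) 1 = expR (- s).
    by apply/min_idPl; rewrite expR_le1 oppr_le0.
  have e1 : expR (z * s) - 1 <= z * s / (1 - z * s).
    have -> : z * s / (1 - z * s) = (1 - z * s)^-1 - 1 by field; lra.
    by rewrite lerD2r expR_le_inv//; lra.
  have e2 : expR (- s) <= (1 + s)^-1.
    by have := @expR_le_inv (- s); rewrite opprK; apply; lra.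
  apply: (@le_trans _ _ (z * s / (1 - z * s) * (1 + s)^-1)).
    apply: ler_pM => //; rewrite ?expR_ge0//.
    by rewrite subr_ge0 -[leLHS]expR0 ler_expR.
  have -> : z * (s - s ^+ 2 / 2) = z * s * (1 - s / 2) by ring.
  rewrite -mulrA ler_wpM2l// -invfM -[leLHS]mul1r ler_pdivrMr; last first.
    by rewrite mulr_gt0; lra.
  nra.
have -> : Num.min (expR (- s)) 1 = 1.
  by apply/min_idPr; rewrite -expR0 ler_expR oppr_ge0 ltW.
rewrite mulr1.
have zs : z * s <= 0 by rewrite mulr_ge0_le0// ltW.
have zs1 : - (1/8) <= z * s by nra.
apply: (@le_trans _ _ (z * s + (z * s) ^+ 2)).
  rewrite lerBlDl (le_trans (expR_le_inv _))//; first lra.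
  rewrite -[leLHS]mul1r ler_pdivrMr; last lra.
  have -> : (1 + (z * s + (z * s) ^+ 2)) * (1 - z * s) = 1 - z * s * (z * s) ^+ 2.
    by ring.
  by rewrite lerBrDl gerDr mulr_le0_ge0// sqr_ge0.
rewrite mulrDr lerD2l exprMn expr2 -mulrA ler_wpM2l ?(ltW z0)//.
by rewrite mulrC ler_wpM2l ?sqr_ge0//; lra.
Qed.

Lemma gain_bound_lip s a : `|s| <= 1/4 -> `|a| <= 1/4 ->
  gain_bound s - gain_bound a <= `|s - a|.
Proof.
rewrite !ler_norml /gain_bound => /andP[s1 s2] /andP[a1 a2].
by case: (leP 0 s) => s0; case: (leP 0 a) => a0; case: (lerP 0 (s - a)) => sa;
  rewrite ?(ger0_norm sa) ?(ltr0_norm sa); nra.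
Qed.

(** Two opposite increments, along which the log-density decreases by [a] and
    [- a] up to errors at most [e]. The first-order terms cancel, and the
    damping of upward moves wins over the convexity of the weight. *)
Lemma gain_pair_le z s1 s2 a e : 0 < z <= 1/8 ->
  `|s1 - a| <= e -> `|s2 + a| <= e -> `|a| + e <= 1/4 ->
  gain z s1 + gain z s2 <= z * (2 * e - 3 / 8 * a ^+ 2).
Proof.
move=> z18 s1a s2a ae; have e0 := le_trans (normr_ge0 _) s1a.
have s1_le : `|s1| <= 1/4.
  by have := ler_normD (s1 - a) a; rewrite subrK; lra.
have s2_le : `|s2| <= 1/4.
  by have := ler_normB (s2 + a) a; rewrite addrK; lra.
have a_le : `|a| <= 1/4 by lra.
have Na_le : `|- a| <= 1/4 by rewrite normrN.
have l1 := gain_bound_lip s1_le a_le.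
have := gain_bound_lip s2_le Na_le; rewrite opprK => l2.
have g1 := gain_le z18 s1_le; have g2 := gain_le z18 s2_le.
have b : gain_bound a + gain_bound (- a) <= - (3/8) * a ^+ 2.
  rewrite /gain_bound oppr_ge0 sqrrN.
  by case: (leP 0 a) => a0; case: (leP a 0) => a0'; nra.
apply: (le_trans (lerD g1 g2)); rewrite -mulrDr ler_wpM2l//.
  by case/andP: z18 => /ltW.
lra.
Qed.

End gain.

(** * Concave extension by a tangent *)

Section tangent_extension.
Context {R : realType}.
Implicit Types f df : R -> R.

Lemma MVT_is_derive f df (a b : R) : a < b ->
  (forall x, a <= x <= b -> is_derive x 1 f (df x)) ->
  exists2 c, a < c < b & f b - f a = df c * (b - a).
Proof.
move=> ab fdf; have [||c] := @MVT R f df a b ab.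
- move=> x; rewrite in_itv/= => /andP[/ltW ax /ltW xb].
  by apply: fdf; rewrite ax xb.
- apply: derivable_within_continuous => x; rewrite in_itv/= => xab.
  by have [] := fdf _ xab.
- by rewrite in_itv/= => cab ?; exists c.
Qed.

(** Replacing a function that is concave only on [[v0, +oo[] by its tangent at
    [v0] below [v0] makes it concave everywhere. *)
Definition tangent_extension f (s v0 v : R) : R :=
  if v < v0 then f v0 + s * (v - v0) else f v.

Variables (f df : R -> R) (v0 : R).
Hypothesis fdf : forall v, v0 <= v -> is_derive v 1 f (df v).
Hypothesis df_nincr : forall v w, v0 <= v -> v <= w -> df w <= df v.

Let g := tangent_extension f (df v0) v0.

Let concave_le_tangent v w : v0 <= v -> v0 <= w -> f v <= f w + df w * (v - w).
Proof.
move=> v0v v0w; have [vw|wv|->] := ltgtP v w; last by rewrite subrr mulr0 addr0.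
- have [x /andP[x1 x2]|c /andP[vc cw] E] := @MVT_is_derive f df _ _ vw.
    exact/fdf/(le_trans v0v).
  have := df_nincr (le_trans v0v (ltW vc)) (ltW cw); nra.
- have [x /andP[x1 x2]|c /andP[vc cw] E] := @MVT_is_derive f df _ _ wv.
    exact/fdf/(le_trans v0w).
  have := df_nincr v0w (ltW vc); nra.
Qed.

Let ext_le_tangent v w : v0 <= w -> g v <= f w + df w * (v - w).
Proof.
move=> v0w; rewrite /g /tangent_extension; case: ltP => [vv0|v0v].
  have := concave_le_tangent (lexx v0) v0w; have := df_nincr (lexx v0) v0w; nra.
exact: concave_le_tangent.
Qed.

(* [df (Num.max w v0)] is the slope of the extension at [w], on both sides of
   [v0]. *)
Let ext_supported v w : g v <= g w + df (Num.max w v0) * (v - w).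
Proof.
rewrite [g w]/g /tangent_extension; have [wv0|v0w] := ltP w v0.
  by have := ext_le_tangent v (lexx v0); nra.
exact: ext_le_tangent.
Qed.

Hypothesis df_ge0 : forall v, v0 <= v -> 0 <= df v.

Lemma tangent_extension_homo : {homo g : u v / u <= v}.
Proof.
move=> u v uv; have := ext_supported u v.
have : 0 <= df (Num.max v v0) by rewrite df_ge0// le_max lexx orbT.
nra.
Qed.

(** A function with a supporting line from above at every point is concave. *)
Lemma tangent_extension_concave (D : set R^o) :
  convex_function D (fun v => - g v).
Proof.
move=> t x y _ _; rewrite convRE /unstable.onem.
pose w : R := t%:num * x + (1 - t%:num) * y.
have gx := ext_supported x w; have gy := ext_supported y w.
have t0 : 0 <= t%:num by [].
have t1 : 0 <= 1 - t%:num by rewrite subr_ge0.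
rewrite !mulrN -opprD lerN2 -[conv t x y]/w.
apply: (le_trans (lerD (ler_wpM2l t0 gx) (ler_wpM2l t1 gy))).
by rewrite le_eqVlt; apply/orP; left; apply/eqP; rewrite /w; ring.
Qed.

Lemma tangent_extension_gt0 : df v0 * (v0 - 1) < f v0 -> 1 <= v0 ->
  forall v, 1 <= v -> 0 < g v.
Proof.
move=> fv0 v01 v /tangent_extension_homo; apply: lt_le_trans.
rewrite /g /tangent_extension; case: (ltP 1 v0) => v01'; first nra.
by have : v0 = 1 by [lra]; move: fv0 => /[swap] <-; rewrite subrr mulr0.
Qed.

(* At the junction point both one-sided slopes are [df v0]: the Caratheodory
    quotient of the extension is that of [f] on the right and constant on the
    left. *)
Let ext_derivable v : derivable g v 1.
Proof.
have [vv0|v0v|->] := ltgtP v v0.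
- apply: (@near_eq_derivable _ _ _ (fun v => f v0 + df v0 * (v - v0))).
    near=> u; rewrite /g /tangent_extension.
    by have -> : u < v0 by near: u; exact: lt_nbhsl.
  suff : is_derive v 1 (fun v => f v0 + df v0 * (v - v0)) (df v0) by case.
  apply/is_derive1_caratheodory; exists (cst (df v0)); split => // [u|].
    by rewrite /=; ring.
  exact: cst_continuous.
- apply: (@near_eq_derivable _ _ _ f); last by have [] := fdf (ltW v0v).
  near=> u; rewrite /g /tangent_extension.
  have v0u : v0 < u by near: u; exact: lt_nbhsr.
  by rewrite ltNge (ltW v0u).
- have /is_derive1_caratheodory[q [fq cq qv0]] := fdf (lexx v0).
  pose q' u := if u < v0 then df v0 else q u.
  suff : is_derive v0 1 g (df v0) by case.
  apply/is_derive1_caratheodory; exists q'; split.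
  + move=> u; rewrite /g /q' /tangent_extension ltxx; case: ifP => _; first ring.
    exact: fq.
  + have q'v0 : q' v0 = q v0 by rewrite /q' ltxx.
    move=> A; rewrite q'v0 => nA; have Aq : \forall u \near v0, A (q u) := cq _ nA.
    suff : \forall u \near v0, A (q' u) by [].
    apply: filterS Aq => u Aqu; rewrite /q'; case: ifP => // _.
    by rewrite -qv0; exact: nbhs_singleton nA.
  + by rewrite /q' ltxx.
Unshelve. all: by end_near. Qed.

Lemma tangent_extension_derivable : derivable_from1 g.
Proof.
move=> v _; apply/cvg_ex; have /cvg_ex[/= l gl] := @ext_derivable v.
exists l; apply: cvg_within_filter.
rewrite (_ : (fun h => _) = fun h : R => h^-1 *: (g (h *: 1 + v) - g v)) //.
by apply/funext => h; rewrite /= [h *: _]mulr1 (addrC h).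
Qed.

End tangent_extension.

(** * The subgeometric rate function *)

Section subgeometric_rate.
Context {R : realType}.
Implicit Types a c k v x y : R.

Lemma powR_pred x a : 0 < x -> x `^ a = x * x `^ (a - 1).
Proof.
move=> x0; rewrite -{2}(powRr1 (ltW x0)) -powRD; first by rewrite addrC subrK.
by rewrite (gt_eqF x0) implybT.
Qed.

Lemma nonincreasing_powR a x y : a <= 0 -> 0 < x -> x <= y -> y `^ a <= x `^ a.
Proof.
move=> a0 x0 xy; have y0 := lt_le_trans x0 xy.
rewrite -[a]opprK !(powRN _ (- a)) lef_pV2 ?posrE ?powR_gt0//.
by rewrite ge0_ler_powR ?nnegrE ?oppr_ge0// ltW.
Qed.

Definition subgeometric_rate c k v : R := c * v * (1 + ln v) `^ (- k).

Let drate c k v := c * ((1 + ln v) `^ (- k) - k * (1 + ln v) `^ (- k - 1)).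

Let is_derive_log_powR a v : 1 <= v ->
  is_derive v 1 (fun v => (1 + ln v) `^ a) (a * (1 + ln v) `^ (a - 1) * v^-1).
Proof.
move=> v1; have v0 : 0 < v by exact: lt_le_trans v1.
have L0 : 0 < 1 + ln v by rewrite ltr_wpDr// ln_ge0.
have dL : is_derive v 1 (fun v => 1 + ln v) v^-1.
  have := is_deriveD (is_derive_cst (1 : R) v 1) (is_derive1_ln v0).
  by rewrite add0r.
have dLa := @is_derive1_comp R (fun y : R => y `^ a) (fun v => 1 + ln v) _ _ _
  (is_derive1_powR a L0) dL.
exact: dLa.
Qed.

Let is_derive_rate c k v : 1 <= v ->
  is_derive v 1 (subgeometric_rate c k) (drate c k v).
Proof.
move=> v1; have v0 : 0 < v by exact: lt_le_trans v1.
have dL := is_derive_log_powR (- k) v1.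
rewrite (_ : subgeometric_rate c k = (c \*: id) * (fun v => (1 + ln v) `^ (- k)))//.
apply: is_derive_eq; rewrite /drate /= /GRing.scale /=.
by field; rewrite gt_eqF.
Qed.

Let ddrate c k v := c * (- k * (1 + ln v) `^ (- k - 2) * (ln v - k) / v).

Let is_derive_drate c k v : 1 <= v -> is_derive v 1 (drate c k) (ddrate c k v).
Proof.
move=> v1; have v0 : 0 < v by exact: lt_le_trans v1.
have L0 : 0 < 1 + ln v by rewrite ltr_wpDr// ln_ge0.
have dL := is_derive_log_powR (- k) v1.
have dL1 := is_derive_log_powR (- k - 1) v1.
rewrite (_ : drate c k = (c \*: ((fun v => (1 + ln v) `^ (- k)) -
   (k \*: (fun v => (1 + ln v) `^ (- k - 1))))))//.
apply: is_derive_eq; rewrite /ddrate /= /GRing.scale /=.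
rewrite (@powR_pred (1 + ln v) (- k - 1))// (_ : - k - 1 - 1 = - k - 2); last by ring.
by field; rewrite gt_eqF.
Qed.

(* The rate is concave from [expR k] on, where [k <= ln v]; below, it is
   convex. *)
Let drate_nincr c k v w : 0 < c -> 0 < k -> expR k <= v -> v <= w ->
  drate c k w <= drate c k v.
Proof.
move=> c0 k0 kv; rewrite le_eqVlt => /predU1P[->//|vw].
have v1 : 1 <= v by rewrite (le_trans _ kv)// -[leLHS]expR0 ler_expR ltW.
have [x /andP[vx _]|x /andP[vx xw] E] :=
    @MVT_is_derive R (drate c k) (ddrate c k) _ _ vw.
  exact/is_derive_drate/(le_trans v1).
rewrite -subr_le0 E mulr_le0_ge0 ?subr_ge0 ?(ltW vw)//.
have x0 : 0 < x by rewrite (le_lt_trans _ vx)// (le_trans _ v1).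
have kx : k <= ln x.
  by rewrite -[leLHS]expRK ler_ln ?posrE ?expR_gt0// (le_trans kv)// ltW.
have P0 := powR_ge0 (1 + ln x) (- k - 2).
rewrite /ddrate mulr_ge0_le0 ?(ltW c0)// mulr_le0_ge0 ?invr_ge0 ?(ltW x0)//.
by rewrite mulr_le0_ge0 ?subr_ge0// mulNr oppr_le0 mulr_ge0// ltW.
Qed.

(** The tangent at [expR k] is increasing, and it is nonnegative at 0 because
    the rate is at least its derivative times its argument: so it is positive
    from 1 on. *)
Lemma concave_subgeometric_rate c k : 0 < c -> 0 < k ->
  exists phi : R -> R,
  [/\ forall v, expR k <= v -> phi v = subgeometric_rate c k v,
      forall v, 1 <= v -> 0 < phi v,
      forall D : set R^o, convex_function D (fun v => - phi v),
      {homo phi : u v / u <= v}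
    & derivable_from1 phi].
Proof.
move=> c0 k0; have ek1 : 1 <= expR k by rewrite -[leLHS]expR0 ler_expR ltW.
have df v : expR k <= v -> is_derive v 1 (subgeometric_rate c k) (drate c k v).
  by move=> kv; apply/is_derive_rate/(le_trans ek1).
have nincr v w : expR k <= v -> v <= w -> drate c k w <= drate c k v.
  exact: drate_nincr.
have ln_ge v : expR k <= v -> k <= ln v.
  move=> kv; have v0 : 0 < v by rewrite (lt_le_trans (expR_gt0 k)).
  by rewrite -[leLHS]expRK ler_ln ?posrE ?expR_gt0.
have ge0 v : expR k <= v -> 0 <= drate c k v.
  move=> /ln_ge kv; rewrite /drate (@powR_pred (1 + ln v) (- k)); last lra.
  by rewrite -mulrBl mulr_ge0 ?mulr_ge0 ?powR_ge0 ?(ltW c0)//; lra.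
exists (tangent_extension (subgeometric_rate c k) (drate c k (expR k)) (expR k)).
split.
- by move=> v kv; rewrite /tangent_extension ltNge kv.
- apply: tangent_extension_gt0 => //.
  rewrite /drate /subgeometric_rate expRK -!mulrA ltr_pM2l//.
  have A0 : 0 < (1 + k) `^ (- k) by rewrite powR_gt0//; lra.
  have B0 : 0 < (1 + k) `^ (- k - 1) by rewrite powR_gt0//; lra.
  have kB0 : 0 <= k * (1 + k) `^ (- k - 1) * (expR k - 1).
    by rewrite mulr_ge0 ?subr_ge0// mulr_ge0 ?ltW.
  lra.
- exact: tangent_extension_concave.
- exact: tangent_extension_homo.
- exact: tangent_extension_derivable.
Qed.

End subgeometric_rate.

(** * First-order expansion of the logarithm of a density *)

Section line_derivative.
Context {R : realType} {d : nat}.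
Implicit Types (f p : 'rV[R]_d -> R) (x y u v : 'rV[R]_d).

(** Both difference quotients are the same function. This reduces everything to
    calculus in one variable. *)
Lemma is_derive_line f x u (t l : R) :
  is_derive (x + t *: u) u f l <-> is_derive t 1 (fun t => f (x + t *: u)) l.
Proof.
have E : (fun h : R => h^-1 *: ((f \o shift (x + t *: u)) (h *: u)
                                 - f (x + t *: u))) =
    (fun h => h^-1 *: (((fun t => f (x + t *: u)) \o shift t) (h *: 1)
                        - f (x + t *: u))).
  apply/funext => h /=; congr (_ *: (f _ - _)).
  by rewrite [h *: 1]mulr1 scalerDl addrCA.
by split=> -[D V]; split; move: D V; rewrite /derivable /derive E.
Qed.

Lemma is_derive_delta_mx f y u : differentiable f y ->
  is_derive y u f (\sum_j u 0 j * 'D_(delta_mx 0 j) f y).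
Proof.
move=> df; split; first exact: diff_derivable.
rewrite deriveE// {1}(row_sum_delta u) linear_sum; apply: eq_bigr => j _.
by rewrite linearZ deriveE.
Qed.

Lemma is_derive_ln_comp p y u (l : R) : 0 < p y ->
  is_derive y u p l -> is_derive y u (fun w => ln (p w)) ((p y)^-1 * l).
Proof.
move=> py dp; have y0 : y + 0 *: u = y by rewrite scale0r addr0.
have /is_derive_line dp0 : is_derive (y + 0 *: u) u p l by rewrite y0.
have dln : is_derive (p (y + 0 *: u)) 1 (@ln R) (p y)^-1.
  by rewrite y0; exact: is_derive1_ln.
rewrite -{1}y0; apply/is_derive_line.
exact: (@is_derive1_comp R (@ln R) (fun t => p (y + t *: u)) _ _ _ dln dp0).
Qed.

Variable p : 'rV[R]_d -> R.
Hypothesis p_gt0 : forall y, 0 < p y.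
Let logp y := ln (p y).

Lemma gradient_ln y i : differentiable p y ->
  gradient logp y 0 i = (p y)^-1 * gradient p y 0 i.
Proof.
move=> dp; rewrite !mxE.
have dpi : derivable p y (delta_mx 0 i) by exact: diff_derivable.
by have [_ ->] := is_derive_ln_comp (p_gt0 y) (derivableP dpi).
Qed.

Lemma is_derive_ln_edot y u : differentiable p y ->
  is_derive y u logp (edot (gradient logp y) u).
Proof.
move=> dp.
apply: (is_derive_eq (is_derive_ln_comp (p_gt0 y) (is_derive_delta_mx u dp))).
rewrite edot_rowE mulr_sumr; apply: eq_bigr => j _.
by rewrite gradient_ln// mxE; ring.
Qed.

Lemma is_derive_gradient_ln y u i : C2_at p y ->
  is_derive y u (fun w => gradient logp w 0 i)
    (\sum_j u 0 j * hessian logp y i j).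
Proof.
move=> C2; have [dp dgp _] := nbhs_singleton C2.
pose g w := (p w)^-1 * gradient p w 0 i.
have g_near : \forall w \near y, g w = gradient logp w 0 i.
  by apply: filterS C2 => w [dpw _ _]; rewrite gradient_ln.
have dg : differentiable g y.
  apply: differentiableM.
    apply: (@differentiable_comp _ _ _ _ p (fun z => z^-1)) => //.
    apply/derivable1_diffP.
    have := @is_deriveV R id (p y) 1 1 (lt0r_neq0 (p_gt0 y)) (is_derive_id _ _).
    by case.
  apply: (@differentiable_comp _ _ _ _ (gradient p)
    (fun M : 'rV[R]_d => M 0 i)) => //.
  exact: differentiable_coord.
apply: (near_eq_is_derive g_near); apply: (is_derive_eq (is_derive_delta_mx u dg)).
apply: eq_bigr => j _; rewrite mxE; congr (_ * _).
rewrite (near_eq_derive _ g_near); congr ('D_ _ _ _).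
by apply/funext => w; rewrite mxE.
Qed.

(** The mean value theorem is applied first to [t |-> logp (x + t *: u)], then
    to its derivative, whose slope is a value of the Hessian form. *)
Lemma ln_first_order_bound x u (H : R) :
  (forall t : R, 0 <= t <= 1 -> C2_at p (x + t *: u)) ->
  (forall t : R, 0 <= t <= 1 -> enorm (hessian logp (x + t *: u)) <= H) ->
  `|logp (x + u) - logp x - edot (gradient logp x) u| <= H * enorm u ^+ 2.
Proof.
move=> C2 hess_le.
have d1 (t : R) : 0 <= t <= 1 -> is_derive t 1 (fun t => logp (x + t *: u))
    (edot (gradient logp (x + t *: u)) u).
  move=> /C2 C2t; apply/is_derive_line/is_derive_ln_edot.
  by have [] := nbhs_singleton C2t.
have d2 (t : R) : 0 <= t <= 1 -> is_derive t 1
    (fun t => edot (gradient logp (x + t *: u)) u)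
    (edot (hessian logp (x + t *: u)) (u^T *m u)).
  move=> /C2 C2t; rewrite edot_trmxM.
  rewrite (_ : (fun t => _) =
      \sum_i (u 0 i \*: fun t => gradient logp (x + t *: u) 0 i)).
    apply: is_derive_sum => i; apply: is_deriveZ.
    apply: (is_derive_line (fun w => gradient logp w 0 i) x u t _).1.
    exact: is_derive_gradient_ln.
  apply/funext => s; rewrite edot_rowE fct_sumE; apply: eq_bigr => i _.
  by rewrite mulrC.
have [c /andP[c0 c1]] := MVT_is_derive ltr01 d1.
rewrite scale0r addr0 scale1r subr0 mulr1 => ->.
have d2c (t : R) : 0 <= t <= c -> is_derive t 1
    (fun t => edot (gradient logp (x + t *: u)) u)
    (edot (hessian logp (x + t *: u)) (u^T *m u)).
  by move=> /andP[t0 tc]; apply: d2; rewrite t0 (le_trans tc) ?ltW.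
have [e /andP[e0 ec]] := MVT_is_derive c0 d2c.
rewrite scale0r addr0 subr0 => ->; rewrite normrM (gtr0_norm c0).
have e01 : 0 <= e <= 1 by rewrite !ltW// (lt_trans ec).
have He := hess_le _ e01; have H0 := le_trans (enorm_ge0 _) He.
apply: (le_trans (ler_piMr (normr_ge0 _) (ltW c1))).
apply: (le_trans (edot_le_enormM _ _)).
by rewrite enorm_trmxM ler_wpM2r ?sqr_ge0.
Qed.

End line_derivative.

(** * Integrals against the Metropolis kernel *)

Section metropolis.
Context {R : realType} {d : nat}.
Variables (p q : 'rV[R]_d -> R).
Hypotheses (mp : measurable_fun setT p) (p_gt0 : forall x, 0 < p x).
Hypotheses (mq : measurable_fun setT q) (q_ge0 : forall u, 0 <= q u).
Hypothesis q1 : (\int[@lebesgue_rV R d]_u (q u)%:E = 1)%E.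
Let P := metropolis_kernel p q.
Let mu := @lebesgue_rV R d.
Implicit Types (x y u : 'rV[R]_d) (W : 'rV[R]_d -> R).

Lemma acceptance_ge0 x y : 0 <= acceptance p x y.
Proof. by rewrite /acceptance p_gt0 le_min ler01 divr_ge0// ltW. Qed.

Lemma acceptance_le1 x y : acceptance p x y <= 1.
Proof. by rewrite /acceptance p_gt0 ge_min lexx orbT. Qed.

Lemma acceptanceE x y : acceptance p x y = Num.min (expR (ln (p y) - ln (p x))) 1.
Proof. by rewrite /acceptance p_gt0 expRD expRN !lnK ?posrE. Qed.

Let macc x : measurable_fun setT (fun u => acceptance p x (x + u)).
Proof.
rewrite /acceptance p_gt0; apply: measurable_minr => //.
apply: measurable_funM => //.
by apply: measurableT_comp => //; exact: measurable_rV_addl.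
Qed.

(** Conditioning on the proposed increment [u]: the weight becomes that of
    [x + u] or remains that of [x]. *)
Lemma metropolis_appE W x : measurable_fun setT W -> (forall y, 0 <= W y) ->
  kernel_app P W x =
  (\int[mu]_u ((W (x + u) * acceptance p x (x + u)
                 + W x * (1 - acceptance p x (x + u))) * q u)%:E)%E.
Proof.
move=> mW W0; set a := fun u => acceptance p x (x + u).
have a0 u : 0 <= a u by exact: acceptance_ge0.
have a1 u : 0 <= 1 - a u by rewrite subr_ge0; exact: acceptance_le1.
have ma : measurable_fun setT a by exact: macc.
have m1a : measurable_fun setT (fun u => (1 - a u) * q u).
  by apply: measurable_funM => //; exact: measurable_funB.
pose k := fine (\int[mu]_u ((1 - a u) * q u)%:E)%E.
have k0 : 0 <= k.
  by apply: fine_ge0; apply: integral_ge0 => u _; rewrite lee_fin mulr_ge0.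
have kE : (\int[mu]_u ((1 - a u) * q u)%:E = k%:E)%E.
  rewrite fineK// ge0_fin_numE; last first.
    by apply: integral_ge0 => u _; rewrite lee_fin mulr_ge0.
  apply: (@le_lt_trans _ _ (\int[mu]_u (q u)%:E)%E); last by rewrite q1 ltry.
  apply: ge0_le_integral => //.
  - by move=> u _; rewrite lee_fin mulr_ge0.
  - exact/measurable_EFinP.
  - exact/measurable_EFinP.
  - by move=> u _; rewrite lee_fin ler_piMl// lerBlDr lerDl.
have PE : P x = (fun A => \int[mu]_u (\1_A (x + u) * (a u * q u))%:E
    + (\1_A x)%:E * (NngNum k0)%:num%:E)%E.
  apply/funext => A; rewrite /P /metropolis_kernel -/mu kE; congr (_ + _)%E.
  by apply: eq_integral => u _; rewrite mulrA.
have mxu : measurable_fun setT (fun u => W (x + u)).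
  by apply: measurableT_comp => //; exact: measurable_rV_addl.
have maq : measurable_fun setT (fun u => a u * q u) by exact: measurable_funM.
have aq0 u : 0 <= a u * q u by rewrite mulr_ge0.
rewrite /kernel_app PE.
rewrite (@ge0_integral_image_add_dirac _ _ _ _ R mu (+%R x) (fun u => a u * q u)
  (measurable_rV_addl x) maq aq0 x (NngNum k0) W mW W0).
rewrite /= EFinM -kE -ge0_integralZl_EFin//; last 2 first.
  by move=> u _; rewrite lee_fin mulr_ge0.
  exact/measurable_EFinP.
rewrite -ge0_integralD//; last 4 first.
  by move=> u _; rewrite lee_fin !mulr_ge0.
  by apply/measurable_EFinP/measurable_funM.
  by move=> u _; rewrite lee_fin !mulr_ge0.
  by apply/measurable_EFinP/measurable_funM.
by apply: eq_integral => u _; rewrite -EFinM -EFinD /a; congr (_%:E); ring.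
Qed.

(** A crude bound, which suffices on a bounded set. *)
Lemma metropolis_app_le W x :
  measurable_fun setT W -> (forall y, 0 <= W y) ->
  (forall y, W y * acceptance p x y <= W x) ->
  (kernel_app P W x <= (2 * W x)%:E)%E.
Proof.
move=> mW W0 Wacc; rewrite metropolis_appE//.
have -> : (2 * W x)%:E = (\int[mu]_u ((2 * W x)%:E * (q u)%:E))%E.
  rewrite ge0_integralZl_EFin// ?q1 ?mule1// ?mulr_ge0//.
    by move=> u _; rewrite lee_fin.
  exact/measurable_EFinP.
have mxu : measurable_fun setT (fun u => W (x + u)).
  by apply: measurableT_comp => //; exact: measurable_rV_addl.
apply: ge0_le_integral => //.
- move=> u _; rewrite lee_fin mulr_ge0// addr_ge0// mulr_ge0// ?acceptance_ge0//.
  by rewrite subr_ge0 acceptance_le1.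
- apply/measurable_EFinP/measurable_funM => //; apply: measurable_funD.
    exact: measurable_funM.
  by apply: measurable_funM => //; exact: measurable_funB.
- by apply/measurable_EFinP/measurable_funM.
- move=> u _; rewrite -EFinM lee_fin ler_wpM2r// mulrDl !mul1r lerD//.
  by rewrite ler_piMr// lerBlDr lerDl acceptance_ge0.
Qed.

End metropolis.

(** * Drift at one point *)

Section drift_estimate.
Context {R : realType} {d : nat}.
Variables (p q : 'rV[R]_d -> R).
Hypotheses (mp : measurable_fun setT p) (p_gt0 : forall x, 0 < p x).
Let mu := @lebesgue_rV R d.
Implicit Types (x y u g : 'rV[R]_d) (W : 'rV[R]_d -> R) (z t e r : R).

Let powRE x (a : R) : p x `^ a = expR (a * ln (p x)).
Proof. by rewrite /powR gt_eqF. Qed.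

Lemma one_step_gain z x y :
  p y `^ (- z) * acceptance p x y + p x `^ (- z) * (1 - acceptance p x y) =
  p x `^ (- z) * (1 + gain z (ln (p x) - ln (p y))).
Proof.
have -> : p y `^ (- z) = p x `^ (- z) * expR (z * (ln (p x) - ln (p y))).
  by rewrite !powRE -expRD; congr expR; ring.
by rewrite acceptanceE// /gain opprB; ring.
Qed.

Lemma one_step_gain_ge0 z x y : 0 <= 1 + gain z (ln (p x) - ln (p y)).
Proof.
rewrite -(pmulr_rge0 _ (powR_gt0 (- z) (p_gt0 x))) -one_step_gain.
rewrite addr_ge0 ?mulr_ge0 ?powR_ge0 ?acceptance_ge0//.
by rewrite subr_ge0 acceptance_le1.
Qed.

(** The acceptance probability [min w 1] is at most [w `^ z]. *)
Lemma powR_acceptance_le z x y : 0 <= z <= 1 ->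
  p y `^ (- z) * acceptance p x y <= p x `^ (- z).
Proof.
move=> /andP[z0 z1]; rewrite acceptanceE// !powRE.
have [yx|xy] := leP (ln (p y)) (ln (p x)).
  apply: (@le_trans _ _ (expR (- z * ln (p y)) * expR (ln (p y) - ln (p x)))).
    by rewrite ler_wpM2l ?expR_ge0// ge_min lexx.
  by rewrite -expRD ler_expR; nra.
apply: (@le_trans _ _ (expR (- z * ln (p y)) * 1)).
  by rewrite ler_wpM2l ?expR_ge0// ge_min lexx orbT.
by rewrite mulr1 ler_expR; nra.
Qed.

(** The truncation [Num.max t] lets one argument serve both the weight itself
    ([t = 0]) and its truncation from below at 1 ([t = 1]). *)
Lemma max_powR_acceptance_le z t x y : 0 <= z <= 1 -> 0 <= t ->
  Num.max t (p y `^ (- z)) * acceptance p x y <= Num.max t (p x `^ (- z)).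
Proof.
move=> z01 t0; rewrite maxr_pMl ?acceptance_ge0// ge_max !le_max.
by rewrite ler_piMr ?acceptance_le1//= powR_acceptance_le// orbT.
Qed.

(** The ball is centred at distance [r / 2] from the origin in the direction of
    [g]. Its radius does not depend on [g], hence neither does its measure. If
    the increments have a density bounded below near 0, this makes the mean
    square of [edot g] at least a fixed multiple of [enorm g ^+ 2]. The factor [d%:R] converts the sup norm into the
    Euclidean one. *)
Lemma ball_in_halfspace g r : (0 < d)%N -> 0 < r -> 0 < enorm g ->
  exists c, forall u, ball c (r / (4 * d%:R)) u ->
    ball 0 r u /\ enorm g * (r / 4) <= edot g u.
Proof.
move=> d0 r0 g0; have dR : (1 : R) <= d%:R by rewrite ler1n.
have rd : r / (4 * d%:R) <= r / 4.
  rewrite ler_pM2l// lef_pV2 ?posrE;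
    [by rewrite ler_peMr|by rewrite mulr_gt0//; lra|lra].
exists ((r / 2 / enorm g) *: g) => u; set c := _ *: g.
have cE : enorm c = r / 2.
  rewrite enormZ gtr0_norm; last by rewrite divr_gt0// divr_gt0.
  by rewrite divfK// gt_eqF.
rewrite !mx_norm_ball /ball_ /= => cu; split.
  rewrite sub0r normrN -[u](subKr c).
  have c_le : `|c| <= r / 2 by rewrite -cE mx_norm_le_enorm.
  have := ler_normB c (c - u); lra.
have uc : enorm (u - c) <= r / 4.
  rewrite (le_trans (enorm_le_mx_norm _))// distrC.
  apply: (@le_trans _ _ (d%:R * (r / (4 * d%:R)))).
    by rewrite ler_wpM2l// ltW.
  by rewrite le_eqVlt; apply/orP; left; apply/eqP; field; lra.
have gc : edot g c = r / 2 * enorm g.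
  by rewrite edotZr -sqr_enorm; field; rewrite gt_eqF.
rewrite -[u](subrK c) edotDr gc.
have := edot_le_enormM g (u - c); rewrite ler_norml => /andP[ge _].
have := ler_wpM2l (ltW g0) uc; lra.
Qed.

(** The increments [u] and [- u] are equally likely, so the expected gain is
    half that of the pair, and [gain_pair_le] applies with [a = - edot g u]. The
    negative term is kept on the ball only, as an indicator function: all
    integrands are then nonnegative. *)
Lemma drift_estimate W x g (z e q0 : R) (c : 'rV[R]_d) (s w : R) :
  measurable_fun setT q -> (forall u, 0 <= q u) -> (forall u, q (- u) = q u) ->
  (\int[mu]_u (q u)%:E = 1)%E ->
  measurable_fun setT W -> (forall y, 0 <= W y) -> W x = p x `^ (- z) ->
  0 < z <= 1/8 -> 0 <= e -> 0 <= s -> 0 < w -> 0 < q0 ->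
  (forall u, q u != 0 ->
    [/\ W (x + u) = p (x + u) `^ (- z),
        `|ln (p (x + u)) - ln (p x) - edot g u| <= e
      & `|edot g u| + e <= 1/4]) ->
  (forall u, ball c w u -> q0 <= q u /\ s <= edot g u) ->
  (kernel_app (metropolis_kernel p q) W x <=
    (W x * (1 + z * e - 3/16 * z * s ^+ 2 * q0 * (w *+ 2) ^+ d))%:E)%E.
Proof.
move=> mq q_ge0 qN q1 mW W0 Wx z18 e0 s0 w0 q00 near_x halfspace.
have /andP[z0 _] := z18.
have Wx0 : 0 < W x by rewrite Wx powR_gt0.
pose D u := ln (p x) - ln (p (x + u)).
pose h u := (1 + gain z (D u)) * q u.
have h0 u : 0 <= h u by rewrite mulr_ge0// one_step_gain_ge0.
have mpx : measurable_fun setT (fun u => p (x + u)).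
  by apply: measurableT_comp => //; exact: measurable_rV_addl.
have mD : measurable_fun setT D.
  by apply: measurable_funB => //; apply: measurableT_comp.
have mh : measurable_fun setT h.
  apply: measurable_funM => //; apply: measurable_funD => //.
  apply: measurable_funM.
    apply: measurable_funB => //; apply: measurableT_comp => //.
    exact: measurable_funM.
  apply: measurable_minr => //; apply: measurableT_comp => //.
  exact: measurableT_comp.
have -> : kernel_app (metropolis_kernel p q) W x =
    ((W x)%:E * \int[mu]_u (h u)%:E)%E.
  rewrite metropolis_appE// -ge0_integralZl_EFin//; last 2 first.
    by move=> u _; rewrite lee_fin.
    exact/measurable_EFinP.
  apply: eq_integral => u _; rewrite -EFinM; congr (_%:E).
  have [qu0|qu] := eqVneq (q u) 0; first by rewrite /h qu0 !mulr0.
  by have [-> _ _] := near_x _ qu; rewrite Wx one_step_gain// /h mulrA.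
have mhN : measurable_fun setT (fun u => h (- u)).
  by apply: measurableT_comp => //; exact: measurable_rV_opp.
pose b := 3/8 * z * s ^+ 2 * q0.
have b0 : 0 <= b by rewrite /b !mulr_ge0 ?sqr_ge0 ?(ltW z0) ?(ltW q00)//.
have mB := @measurable_rV_ball R d c w w0.
have pointwise u : h u + h (- u) + b * \1_(ball c w) u <= (2 + 2 * z * e) * q u.
  rewrite /h qN indicE.
  have [qu0|qu] := eqVneq (q u) 0.
    rewrite qu0 !mulr0 !add0r; case: (boolP (u \in _)); last by rewrite mulr0.
    by move=> /set_mem /halfspace []; rewrite qu0 leNgt q00.
  have [_ Du ae] := near_x _ qu.
  have quN : q (- u) != 0 by rewrite qN.
  have [_ DNu _] := near_x _ quN; rewrite edotNr opprK in DNu.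
  have gains : gain z (D u) + gain z (D (- u))
      <= z * (2 * e - 3/8 * (edot g u) ^+ 2).
    rewrite -(sqrrN (edot g u)); apply: gain_pair_le => //.
    - by rewrite /D -normrN; congr (`|_| <= _): Du; ring.
    - by rewrite /D -normrN; congr (`|_| <= _): DNu; ring.
    - by rewrite normrN.
  have q0u : 0 < q u by rewrite lt_neqAle eq_sym qu q_ge0.
  case: (boolP (u \in _)) => uB; last first.
    rewrite mulr0 addr0 -mulrDl ler_pM2r//.
    have a20 := sqr_ge0 (edot g u).
    have : 0 <= z * (3/8 * edot g u ^+ 2) by rewrite mulr_ge0 ?(ltW z0)//; lra.
    lra.
  have [q0q sg] := halfspace _ (set_mem uB).
  have : b <= z * (3/8 * edot g u ^+ 2) * q u.
    rewrite /b; have -> : 3/8 * z * s ^+ 2 * q0 = z * (3/8 * s ^+ 2) * q0 by ring.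
    have ss : s ^+ 2 <= edot g u ^+ 2 by rewrite ler_sqr ?nnegrE ?(le_trans s0).
    have s20 := sqr_ge0 s.
    apply: ler_pM => //; [by rewrite mulr_ge0//; [exact: ltW|lra]|exact: ltW|].
    by rewrite ler_pM2l//; lra.
  move: gains; rewrite -(ler_pM2r q0u) /= mulr1; lra.
pose I := (\int[mu]_u (h u)%:E)%E.
have two_h : (I + I + (b * (w *+ 2) ^+ d)%:E <= (2 + 2 * z * e)%:E)%E.
  have -> : (b * (w *+ 2) ^+ d)%:E = (\int[mu]_u (b * \1_(ball c w) u)%:E)%E.
    under eq_integral do rewrite EFinM.
    rewrite ge0_integralZl_EFin//.
      by rewrite integral_indic// setIT EFinM -(lebesgue_rV_ball c w0).
    exact/measurable_EFinP/measurable_indic.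
  rewrite -[leRHS]mule1 -q1 -ge0_integralZl_EFin//; last 3 first.
    by move=> u _; rewrite lee_fin.
    exact/measurable_EFinP.
    by rewrite addr_ge0// !mulr_ge0// ltW.
  have {2}-> : I = (\int[mu]_u (h (- u)%R)%:E)%E.
    rewrite /I -(@ge0_integral_oppr R d (EFin \o h))//.
    exact/measurable_EFinP.
  have mbB : measurable_fun setT (fun u => b * \1_(ball c w) u).
    by apply: measurable_funM => //; exact: measurable_indic.
  have bB0 u : 0 <= b * \1_(ball c w) u by rewrite mulr_ge0.
  rewrite /I -ge0_integralD//; last 4 first.
    by move=> u _; rewrite lee_fin.
    exact/measurable_EFinP.
    by move=> u _; rewrite lee_fin.
    exact/measurable_EFinP.
  rewrite -ge0_integralD//; last 4 first.
    by move=> u _; rewrite -EFinD lee_fin addr_ge0.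
    by apply/measurable_EFinP/measurable_funD.
    by move=> u _; rewrite lee_fin.
    exact/measurable_EFinP.
  apply: ge0_le_integral => //.
  - by move=> u _; rewrite -!EFinD lee_fin !addr_ge0.
  - by apply/measurable_EFinP; apply: measurable_funD => //; exact: measurable_funD.
  - by apply/measurable_EFinP/measurable_funM.
  - by move=> u _; rewrite -!EFinD -EFinM lee_fin; exact: pointwise.
have I0 : (0 <= I)%E by apply: integral_ge0 => u _; rewrite lee_fin.
have Ifin : I \is a fin_num.
  rewrite ge0_fin_numE// (@le_lt_trans _ _ (2 + 2 * z * e)%:E) ?ltry//.
  apply: le_trans two_h; rewrite -addeA leeDl// adde_ge0// lee_fin mulr_ge0//.
  by rewrite exprn_ge0// mulrn_wge0// ltW.
rewrite -/I; move: two_h; rewrite -(fineK Ifin) -!EFinD -EFinM !lee_fin => two_h.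
rewrite ler_pM2l//; move: two_h; rewrite /b; lra.
Qed.

End drift_estimate.

(** * Drift far from the origin *)

Section far_drift.
Context {R : realType} {d : nat}.
Implicit Types (p q : 'rV[R]_d -> R) (x y u : 'rV[R]_d) (W : 'rV[R]_d -> R).

Lemma powR_eventually_small (a e : R) : 0 < a -> 0 < e ->
  exists2 rho : R, 0 < rho & forall s, rho <= s -> s `^ (- a) <= e.
Proof.
move=> a0 e0; have rho0 : 0 < e `^ (- a^-1) by rewrite powR_gt0.
exists (e `^ (- a^-1)) => // s rs; have s0 := lt_le_trans rho0 rs.
have e_inv : (e `^ (- a^-1)) `^ a = e^-1.
  by rewrite -powRrM mulNr mulVf ?gt_eqF// powR_inv1// ltW.
rewrite powRN -[e]invrK -e_inv lef_pV2 ?posrE ?powR_gt0//.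
by rewrite ge0_ler_powR ?nnegrE// ltW.
Qed.

Lemma measurable_max_powR p (t a : R) : measurable_fun setT p ->
  measurable_fun setT (fun x => Num.max t (p x `^ a)).
Proof.
move=> mp; apply: measurable_maxr => //.
by apply: (measurableT_comp (@measurable_powR R a)).
Qed.

Lemma measurable_enorm_ball (rho : R) :
  measurable [set x : 'rV[R]_d | enorm x <= rho].
Proof.
have mE : measurable_fun setT
    (fun x : 'rV[R]_d => Num.sqrt (\sum_j x 0 j * x 0 j)).
  apply: (measurableT_comp (continuous_measurable_fun (@sqrt_continuous R))).
  apply: measurable_sum => j.
  by apply: measurable_funM; exact: measurable_rV_coord.
rewrite (_ : [set x | _] =
    (fun x : 'rV[R]_d => Num.sqrt (\sum_j x 0 j * x 0 j)) @^-1` `]-oo, rho]%classic).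
  exact: measurable_preimage.
by apply/seteqP; split => x /=; rewrite in_itv/= /enorm edot_rowE.
Qed.

Lemma drift_inequality_intro p q (psi : R -> R) W (rho b : R) :
  (forall x, rho < enorm x ->
     (kernel_app (metropolis_kernel p q) W x <= (W x - psi (W x))%:E)%E) ->
  (forall x, enorm x <= rho ->
     (kernel_app (metropolis_kernel p q) W x <= (2 * W x)%:E)%E
     /\ W x + psi (W x) <= b) ->
  drift_inequality (metropolis_kernel p q) psi W [set x | enorm x <= rho].
Proof.
move=> far near; exists b => x; rewrite indicE.
have [xr|xr] := leP (enorm x) rho.
  rewrite mem_set// mulr1; have [Px Wb] := near _ xr.
  apply: (le_trans (leeD2r _ Px)); rewrite -EFinD lee_fin; lra.
rewrite memNset; last by move=> /=; rewrite leNgt xr.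
rewrite mulr0 addr0; apply: (le_trans (leeD2r _ (far _ xr))).
by rewrite -EFinD subrK.
Qed.

(** In [drift_estimate] at [x] with [enorm x = s], the error [e] is a bound of
    the Hessian, of order [s `^ (m - 2)], and the gradient is of order
    [s `^ (m - 1)]. Since [m > 0], the square of the latter dominates. *)
Lemma metropolis_far_drift p q (m z R1 : R) : (0 < d)%N ->
  probability_density p -> target_assumption m p -> proposal_assumption q ->
  0 < z <= 1/8 ->
  exists eta rho : R, [/\ 0 < eta, 0 < rho & forall W x,
    measurable_fun setT W -> (forall y, 0 <= W y) ->
    (forall y, R1 <= enorm y -> W y = p y `^ (- z)) ->
    rho <= enorm x ->
    (kernel_app (metropolis_kernel p q) W x
      <= (W x * (1 - z * eta * enorm x `^ (2 * m - 2)))%:E)%E].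
Proof.
move=> d0 [mp _ _] [_ p_gt0 /andP[m0 m1]
  [r [d0' [D0 [d1 [D1 [d2 [D2 [R0 [_ _ [d1_gt0 D1_gt0] [_ D2_gt0] tail]]]]]]]]]].
move=> [[mq q_ge0 q1] qN [q0 q0_gt0 q_near] [cq q_supp]] z18.
have [r0 /= r0_gt0 q_ball] :
    exists2 r0 : R, 0 < r0 & forall u, ball 0 r0 u -> q0 <= q u.
  by have /nbhs_ballP[r0 /= r0_gt0 qb] := q_near; exists r0.
(* [c] bounds the increments, and [s - c >= s / 2] will be used. *)
pose c := Num.max cq 1.
have c1 : 1 <= c by rewrite le_max lexx orbT.
have q_supp' u : q u != 0 -> enorm u <= c.
  move=> qu; rewrite le_max; apply/orP; left; rewrite leNgt.
  by apply: contra_neqN qu => /ltW; exact: q_supp.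
pose w := r0 / (4 * d%:R).
have dR : (1 : R) <= d%:R by rewrite ler1n.
have w0 : 0 < w by rewrite divr_gt0// mulr_gt0//; lra.
(* [kappa * s `^ (2 * m - 2)] bounds from below the mean square of the linear
   form given by the gradient, [K * s `^ (m - 2)] the remainder from above. *)
pose kappa := d1 ^+ 2 * (r0 / 4) ^+ 2 * q0 * (w *+ 2) ^+ d.
have kappa0 : 0 < kappa.
  by rewrite !mulr_gt0 ?exprn_gt0 ?divr_gt0 ?pmulrn_lgt0.
pose K := D2 * 2 `^ (2 - m) * c ^+ 2.
have K0 : 0 < K by rewrite !mulr_gt0 ?powR_gt0 ?exprn_gt0//; lra.
have DK0 : 0 < D1 * c + K by rewrite addr_gt0// mulr_gt0//; lra.
have [rho1 _ small1] := @powR_eventually_small (1 - m) (4^-1 / (D1 * c + K))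
  ltac:(lra) ltac:(by rewrite divr_gt0).
have [rho2 _ small2] := @powR_eventually_small m (kappa / 16 / K)
  m0 ltac:(by rewrite !divr_gt0).
(* Beyond [rho1] log-density increments are at most [1/4]; beyond [rho2] the
   remainder is at most [1/16] of the main term. *)
pose rho := Num.max (Num.max rho1 rho2) (Num.max (2 * c) (Num.max R0 R1 + c)).
have rho_ge : [/\ rho1 <= rho, rho2 <= rho, 2 * c <= rho, R0 + c <= rho
    & R1 + c <= rho].
  by rewrite /rho; split; rewrite !le_max ?lerD2r ?le_max ?lexx ?orbT.
exists (kappa / 8), rho; split; [by rewrite divr_gt0| |].
  by case: rho_ge => _ _ cr _ _; lra.
move=> W x mW W0 WE rx; case: rho_ge => r1 r2 rc rR0 rR1.
set s := enorm x in rx *.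
have s_gt0 : 0 < s by lra.
have far_seg u (t : R) : enorm u <= c -> 0 <= t <= 1 ->
    s / 2 <= enorm (x + t *: u) /\ s - c <= enorm (x + t *: u).
  move=> uc /andP[t0 t1].
  have := enormD (x + t *: u) (- (t *: u)).
  rewrite addrK enormN enormZ ger0_norm// -/s.
  have := ler_pM t0 (enorm_ge0 u) t1 uc; lra.
have [_ _ _ /andP[g_ge g_le] _] := tail x ltac:(rewrite -/s; lra).
rewrite -/s in g_ge g_le.
set g := gradient _ x in g_ge g_le.
have P1 := powR_gt0 (m - 1) s_gt0; have P2 := powR_gt0 (m - 2) s_gt0.
have g0 : 0 < enorm g by rewrite (lt_le_trans _ g_ge)// mulr_gt0.
have [b0 halfspace] := ball_in_halfspace d0 r0_gt0 g0.
have remainder u : enorm u <= c ->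
    `|ln (p (x + u)) - ln (p x) - edot g u| <= K * s `^ (m - 2).
  move=> uc.
  have near_tail (t : R) : 0 <= t <= 1 -> R0 <= enorm (x + t *: u).
    by move=> t01; have [_] := far_seg u t uc t01; lra.
  pose H := D2 * (s / 2) `^ (m - 2).
  apply: (@le_trans _ _ (H * enorm u ^+ 2)).
    apply: ln_first_order_bound => // t t01;
      have := tail _ (near_tail _ t01); case => //.
    move=> _ _ _ _ /andP[_ hess]; apply: (le_trans hess).
    rewrite ler_wpM2l ?(ltW D2_gt0)//.
    have [s2 _] := far_seg u t uc t01.
    by rewrite nonincreasing_powR ?divr_gt0// subr_le0 ltW// (lt_trans m1) ?ltr1n.
  have -> : K * s `^ (m - 2) = H * c ^+ 2.
    rewrite /K /H powRM ?invr_ge0//; last exact: ltW.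
    have -> : 2^-1 `^ (m - 2) = 2 `^ (2 - m) :> R.
      by rewrite -[2^-1]powR_inv1// -powRrM mulN1r opprB.
    ring.
  rewrite ler_wpM2l ?ler_sqr ?nnegrE ?enorm_ge0 ?(le_trans ler01 c1)//.
  by rewrite mulr_ge0 ?powR_ge0// ltW.
have s1 : 1 <= s by lra.
have P21 : s `^ (m - 2) <= s `^ (m - 1) by rewrite ler_powR//; lra.
have first_order u : enorm u <= c -> `|edot g u| <= D1 * c * s `^ (m - 1).
  move=> uc; apply: (le_trans (edot_le_enormM _ _)).
  have := ler_pM (enorm_ge0 g) (enorm_ge0 u) g_le uc; lra.
have small u : enorm u <= c -> `|edot g u| + K * s `^ (m - 2) <= 1/4.
  move=> uc; have := first_order u uc; have := small1 s ltac:(lra).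
  rewrite opprB -(ler_pM2r DK0) divfK ?gt_eqF// => sm1.
  have := ler_wpM2l (ltW K0) P21; lra.
have e_le : K * s `^ (m - 2) <= kappa / 16 * s `^ (2 * m - 2).
  have -> : s `^ (m - 2) = s `^ (2 * m - 2) * s `^ (- m).
    rewrite -powRD; last by rewrite (gt_eqF s_gt0) implybT.
    by congr powR; ring.
  have := small2 s ltac:(lra); rewrite -(ler_pM2r K0) divfK ?gt_eqF// => sm2.
  have := ler_wpM2l (powR_ge0 s (2 * m - 2)) sm2; lra.
have P1E : s `^ (2 * m - 2) = (s `^ (m - 1)) ^+ 2.
  rewrite expr2 -powRD; last by rewrite (gt_eqF s_gt0) implybT.
  by congr powR; ring.
have r40 : 0 <= r0 / 4 by rewrite divr_ge0// ltW.
have gg : kappa * s `^ (2 * m - 2)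
    <= (enorm g * (r0 / 4)) ^+ 2 * q0 * (w *+ 2) ^+ d.
  rewrite P1E; have -> : kappa * s `^ (m - 1) ^+ 2 =
      (d1 * s `^ (m - 1) * (r0 / 4)) ^+ 2 * q0 * (w *+ 2) ^+ d.
    by rewrite /kappa; ring.
  rewrite !ler_wpM2r ?exprn_ge0 ?mulrn_wge0 ?(ltW w0) ?(ltW q0_gt0)//.
  have d1P := mulr_ge0 (mulr_ge0 (ltW d1_gt0) (ltW P1)) r40.
  by rewrite ler_sqr ?nnegrE// ?ler_wpM2r// mulr_ge0 ?enorm_ge0.
have Wx : W x = p x `^ (- z) by apply: WE; rewrite -/s; lra.
apply: (le_trans (@drift_estimate _ _ p q mp p_gt0 W x g z (K * s `^ (m - 2)) q0 b0
  (enorm g * (r0 / 4)) w mq q_ge0 qN q1 mW W0 Wx z18 _ _ w0 q0_gt0 _ _)).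
- by rewrite mulr_ge0// ltW.
- by rewrite mulr_ge0 ?enorm_ge0.
- move=> u /q_supp' uc; split; [|exact: remainder|exact: small].
  apply: WE; have [_] := far_seg u 1 uc ltac:(rewrite ler01 lexx//).
  by rewrite scale1r; lra.
- by move=> u /halfspace[u0 gu]; split => //; exact: q_ball.
rewrite lee_fin ler_wpM2l//; have /andP[z0 _] := z18.
have := ler_wpM2l (ltW z0) e_le; have := ler_wpM2l (ltW z0) gg; lra.
Qed.

End far_drift.

(** * The drift condition *)

Theorem theorem3p1 (R : realType) (d : nat) (m : R) (p q : 'rV[R]_d -> R)
    (hd : (0 < d)%N)
    (hp : probability_density p) (htarget : target_assumption m p)
    (hq : proposal_assumption q) :
  exists z c rho : R, [/\ 0 < z, 0 < c, 0 < rho &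
    let P := metropolis_kernel p q in
    let V := fun x : 'rV[R]_d => p x `^ (- z) in
    let phi := fun v : R => c * v * (1 + ln v) `^ (- (2 * (1 - m) / m)) in
    let C := [set x : 'rV[R]_d | enorm x <= rho] in
    condition_D_tail P phi V C].
Proof.
have [pc p_gt0 /andP[m0 m1]
  [r [d0 [D0 [d1 [D1 [d2 [D2 [R0 [_ [d0_gt0 _] _ _ tail]]]]]]]]]] := htarget.
have [[mq q_ge0 q1] _ _ _] := hq; have [mp _ _] := hp.
have ln_p_tail x : R0 <= enorm x -> ln (p x) <= - (d0 * enorm x `^ m).
  by move=> /tail[_ _ /andP[]]; rewrite lerNr.
have [L [L0 ln_p_le]] : exists L : R, 0 <= L /\ forall x, ln (p x) <= L.
  have [Mp pM] := continuous_bounded_on_enorm_ball R0 pc.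
  exists (ln (Num.max 1 Mp)); split; first by rewrite ln_ge0// le_max lexx.
  move=> x; have [xR|/ltW Rx] := leP (enorm x) R0.
    by rewrite ler_ln ?posrE ?lt_max ?ltr01// le_max pM ?orbT.
  apply: (le_trans (ln_p_tail _ Rx)).
  apply: (@le_trans _ _ 0); last by rewrite ln_ge0// le_max lexx.
  by rewrite oppr_le0 mulr_ge0 ?powR_ge0// ltW.
(* Below [1/8] by the requirements on [gain]; multiplied by the upper bound [L]
   of the log-density it must stay below [1/2], which keeps [1 + ln (V x)] away
   from its zero, where [phi] blows up. *)
pose z := 8^-1 / (1 + L).
have z0 : 0 < z by rewrite divr_gt0//; lra.
have zL : z * (1 + L) = 8^-1 by rewrite divfK//; lra.
have z_le : z <= 1/8 by have := mulr_ge0 (ltW z0) L0; lra.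
have z18 : 0 < z <= 1/8 by rewrite z0.
pose k := 2 * (1 - m) / m.
have k0 : 0 < k by rewrite divr_gt0// mulr_gt0//; lra.
pose V x := p x `^ (- z).
have V_gt0 x : 0 < V x by rewrite powR_gt0.
have lnV x : ln (V x) = - z * ln (p x) by rewrite ln_powR.
have lnV_ge x : - (1/2) <= ln (V x).
  by rewrite lnV; have := ler_wpM2l (ltW z0) (ln_p_le x); lra.
have lnV_tail x : R0 <= enorm x -> z * d0 * enorm x `^ m <= ln (V x).
  by move=> /ln_p_tail /(ler_wpM2l (ltW z0)); rewrite lnV; lra.
have [eta [rho1 [eta0 rho1_gt0 far_drift]]] :=
  metropolis_far_drift (Num.max R0 1) hd hp htarget hq z18.
have [rho2 _ rho2P] := @powR_eventually_small R m (z * d0 / k) m0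
  (divr_gt0 (mulr_gt0 z0 d0_gt0) k0).
pose rho := Num.max (Num.max rho1 rho2) (Num.max R0 1).
have [rho1_le rho2_le rhoR rho_ge1] :
    [/\ rho1 <= rho, rho2 <= rho, Num.max R0 1 <= rho & 1 <= rho].
  rewrite /rho; split; [by rewrite !le_max lexx|by rewrite !le_max lexx orbT| |].
    by rewrite le_max lexx orbT.
  by rewrite !le_max lexx !orbT.
(* Chosen so that [1 + ln (V x) >= z * d0 * enorm x `^ m] turns [phi (V x)] into
   the drift [V x * (z * eta * enorm x `^ (2 * m - 2))], as
   [m * k = 2 - 2 * m]. *)
pose c := z * eta * (z * d0) `^ k.
have zd : 0 < z * d0 by rewrite mulr_gt0.
have c0 : 0 < c by rewrite mulr_gt0 ?powR_gt0// mulr_gt0.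
have [phi1 [phi1E phi1_gt0 phi1_concave phi1_homo phi1_der]] :=
  concave_subgeometric_rate c0 k0.
exists z, c, rho; split => //; first lra.
move=> P V' phi C.
have V_ge1 x : Num.max R0 1 <= enorm x -> 1 <= V x.
  rewrite ge_max => /andP[/lnV_tail lnV0 _].
  rewrite -(lnK (V_gt0 x)) -[leLHS]expR0 ler_expR (le_trans _ lnV0)//.
  by rewrite mulr_ge0 ?powR_ge0 ?(ltW zd).
have far_V x : rho < enorm x -> expR k <= V x.
  move=> xr; have s0 : 0 < enorm x by lra.
  have RX : R0 <= enorm x.
    by apply: le_trans (ltW xr); move: rhoR; rewrite ge_max => /andP[].
  rewrite -(lnK (V_gt0 x)) ler_expR; apply: le_trans (lnV_tail _ RX).
  have := rho2P (enorm x) ltac:(lra); rewrite powRN -(ler_pM2r k0) divfK ?gt_eqF//.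
  have sm := powR_gt0 m s0.
  by rewrite -(ler_pM2r sm) mulrAC mulVf ?gt_eqF// mul1r.
have far_rate x : rho < enorm x ->
    subgeometric_rate c k (V x) <= V x * (z * eta * enorm x `^ (2 * m - 2)).
  move=> xr; have s0 : 0 < enorm x by lra.
  have RX : R0 <= enorm x.
    by apply: le_trans (ltW xr); move: rhoR; rewrite ge_max => /andP[].
  have sm := powR_gt0 m s0.
  rewrite /subgeometric_rate (mulrC c) -(mulrA (V x)) ler_pM2l//.
  have -> : z * eta * enorm x `^ (2 * m - 2) = c * (z * d0 * enorm x `^ m) `^ (- k).
    rewrite powRM ?(ltW zd) ?(ltW sm)// -powRrM (_ : m * - k = 2 * m - 2); last first.
      by rewrite /k; field; lra.
    by rewrite powRN /c; field; rewrite gt_eqF ?powR_gt0.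
  have zs : 0 < z * d0 * enorm x `^ m by rewrite mulr_gt0.
  have zsV := lnV_tail _ RX.
  by rewrite ler_pM2l// nonincreasing_powR ?oppr_le0 ?(ltW k0)//; lra.
have drift t psi : 0 <= t <= 1 ->
    (forall v, expR k <= v -> psi v = subgeometric_rate c k v) ->
    (exists b, forall x, enorm x <= rho ->
      Num.max t (V x) + psi (Num.max t (V x)) <= b) ->
    drift_inequality P psi (fun x => Num.max t (V x)) C.
  move=> /andP[t0 t1] psiE [b bP].
  have mW : measurable_fun setT (fun x => Num.max t (V x)).
    exact: measurable_max_powR.
  have W0 x : 0 <= Num.max t (V x) by rewrite le_max t0.
  apply: (@drift_inequality_intro _ _ _ _ _ _ _ b) => x xr; last first.
    split; last exact: bP.
    apply: metropolis_app_le => // y.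
    by apply: max_powR_acceptance_le => //; lra.
  have tV y : Num.max R0 1 <= enorm y -> Num.max t (V y) = V y.
    by move=> /V_ge1 Vy; apply/max_idPr/(le_trans t1).
  have Rx : Num.max R0 1 <= enorm x by lra.
  have := far_drift _ x mW W0 tV ltac:(lra); move=> /le_trans; apply.
  rewrite tV// lee_fin psiE ?far_V//; have := far_rate x xr; lra.
have [Mi pMi] : exists M : R, forall x, enorm x <= rho -> (p x)^-1 <= M.
  apply: continuous_bounded_on_enorm_ball => x.
  by apply: (@continuousV _ _ p); [rewrite gt_eqF|exact: pc].
have V_le x : enorm x <= rho -> V x <= Mi `^ z.
  move=> /pMi pM; have px := p_gt0 x.
  have -> : V x = (p x)^-1 `^ z by rewrite -(powR_inv1 (ltW px)) -powRrM mulN1r.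
  have ipx : 0 < (p x)^-1 by rewrite invr_gt0.
  by rewrite ge0_ler_powR ?nnegrE ?(ltW z0) ?(ltW ipx) ?(le_trans (ltW ipx)).
split.
  rewrite (_ : V' = fun x => Num.max 0 (V x)); last first.
    by apply/funext => x; apply/esym/max_idPr/ltW.
  apply: drift => //; first by rewrite lexx ler01.
  exists (Mi `^ z + c * Mi `^ z * (2^-1) `^ (- k)) => x xr.
  have VM := V_le x xr; have M0 := le_trans (ltW (V_gt0 x)) VM.
  have lnVx := lnV_ge x.
  rewrite (max_idPr (ltW (V_gt0 x))) lerD//.
  apply: ler_pM; [|exact: powR_ge0|by rewrite ler_pM2l|].
    by rewrite mulr_ge0 ?(ltW c0) ?(ltW (V_gt0 x)).
  by rewrite nonincreasing_powR ?oppr_le0 ?(ltW k0) ?invr_gt0//; lra.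
exists (expR k), phi1; split => //.
- by rewrite -[leLHS]expR0 ler_expR ltW.
- by move=> x; rewrite /C /= => /negP; rewrite -ltNge => /far_V.
split.
- by move=> x; rewrite le_max lexx.
- by split => //; exact: in2W.
- exact: measurable_enorm_ball.
- apply: drift => //; first by rewrite ler01 lexx.
  exists (Num.max 1 (Mi `^ z) + phi1 (Num.max 1 (Mi `^ z))) => x xr.
  have WM : Num.max 1 (V x) <= Num.max 1 (Mi `^ z).
    by rewrite ge_max !le_max lexx V_le// orbT.
  by rewrite lerD// phi1_homo.
Qed.
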